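(* Let $X$ be a real complete Hausdorff locally convex space with topological dual $X^*$. Let $U$ be a nonempty subset of $X^*$ that is open with respect to the Mackey topology $\tau(X^*,X)$, and let $f:X\to\mathbb{R}\cup\{+\infty\}$ be a function such that $f-x^*$ attains its minimum for every $x^*\in U$. Then for every $\gamma\in\mathbb{R}$ and every $x^*\in U$ the sets $$\{(x,\alpha)\in X\times\mathbb{R} : f(x)-\langle x^*,x\rangle\le\alpha\le\gamma\}\quad\text{and}\quad \{x\in X : f(x)-\langle x^*,x\rangle\le\gamma\}$$ are relatively weakly compact (in $X\times\mathbb{R}$ and in $X$, respectively). In particular, $f$ is an epi-pointed function.
   Context: $\langle x^*,x\rangle:=x^*(x)$ for $x^*\in X^*$, $x\in X$. The Mackey topology $\tau(X^*,X)$ on $X^*$ is the topology having as a basis of neighborhoods of zero the polar sets $\{x^*\in X^*: \sup_{x\in K}\langle x^*,x\rangle\le 1\}$ of all weakly compact circled (balanced) convex sets $K\subseteq X$. For a function $f:X\to\mathbb{R}\cup\{+\infty\}$, $\operatorname{dom} f:=\{x: f(x)<+\infty\}$; $f$ is proper if $\operatorname{dom} f\ne\emptyset$ (similarly for functions on $X^*$). ''$f-x^*$ attains its minimum'' means that there is $\bar x\in X$ with $f(\bar x)$ finite and $f(\bar x)-\langle x^*,\bar x\rangle\le f(y)-\langle x^*,y\rangle$ for all $y\in X$. The conjugate of $f$ is $f^*(x^* ):=\sup_{x\in X}(\langle x^*,x\rangle-f(x))$, $x^*\in X^*$. The function $f$ is called epi-pointed if $f^*$ is proper and $\tau(X^*,X)$-continuous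 at some point of its domain. *)

(* Defs.v *)
From HB Require Import structures.
From mathcomp Require Import all_boot all_order all_algebra.
From mathcomp Require Import lra.
From mathcomp Require Import all_classical all_reals all_analysis.

Set Implicit Arguments.
Unset Strict Implicit.
Unset Printing Implicit Defensive.

Import Order.TTheory GRing.Theory Num.Theory.
Import numFieldNormedType.Exports.

Local Open Scope classical_set_scope.
Local Open Scope ring_scope.

(* Completeness for the uniformity induced by the vector space topology, i.e.
   every filter containing arbitrarily small sets converges.  The library's
   [completeType] refers to the entourages of the underlying [uniformType],
   and [tvsType] does not require these to be translation invariant. *)
Definition tvs_complete (R : realType) (X : tvsType R) : Prop :=
  forall F : set_system X, ProperFilter F ->
    (forall V : set X, nbhs 0 V ->
      exists2 A : set X, F A & forall x y, A x -> A y -> V (x - y)) ->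
    exists x : X, F --> x.

Definition continuous_linear (R : realType) (X : tvsType R) :
  {pred X -> R^o} := fun f => `[< linear f /\ continuous f >].

Record dual (R : realType) (X : tvsType R) := Dual {
  dual_fun :> X -> R^o;
  dual_funP : dual_fun \in @continuous_linear R X }.

HB.instance Definition _ (R : realType) (X : tvsType R) :=
  [isSub for @dual_fun R X].
HB.instance Definition _ (R : realType) (X : tvsType R) :=
  [Choice of @dual R X by <:].

Lemma continuous_linear_submod (R : realType) (X : tvsType R) :
  submod_closed (@continuous_linear R X).
Proof.
split=> [|a f g].
  apply/asboolP; split=> [b u v|]; last exact: cst_continuous.
  by rewrite /= scaler0 addr0.
move=> /asboolP[lf cf] /asboolP[lg cg]; apply/asboolP; split.
  move=> b u v; rewrite /= !fctE lf lg !scalerDr !scalerA (mulrC a b).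
  by rewrite -!addrA; congr (_ + _); rewrite addrCA.
move=> x; apply: cvgD; last exact: cg.
by apply: cvgZl_tmp; exact: cf.
Qed.

HB.instance Definition _ (R : realType) (X : tvsType R) :=
  GRing.isSubmodClosed.Build R (X -> R^o) (@continuous_linear R X)
    (@continuous_linear_submod R X).
HB.instance Definition _ (R : realType) (X : tvsType R) :=
  [SubChoice_isSubLmodule of @dual R X by <:].

(* The carrier X with the weak topology sigma(X, X^* ). *)
Definition weak (R : realType) (X : tvsType R) : topologicalType :=
  sup_topology (fun phi : dual X =>
    Topological.on (initial_topology (phi : X -> R^o))).

Definition weakly_compact (R : realType) (X : tvsType R) (A : set X) : Prop :=
  compact (A : set (weak X)).

Definition relatively_weakly_compact (R : realType) (X : tvsType R)
  (A : set X) : Prop := compact (closure (A : set (weak X))).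

Definition circled (R : realType) (X : tvsType R) (A : set X) : Prop :=
  forall (a : R) (x : X), `|a| <= 1 -> A x -> A (a *: x).

Definition mackey_gauge (R : realType) (X : tvsType R) (K : set X) : Prop :=
  [/\ weakly_compact K, circled K & convex_set K].

Definition polar (R : realType) (X : tvsType R) (K : set X) : set (dual X) :=
  [set phi | (ereal_sup [set (phi x)%:E | x in K] <= 1%:E)%E].

(* The carrier X^* with the Mackey topology tau(X^*, X); the neighborhoods of
   [phi] are the supersets of the translates [phi + polar K]. *)
Definition mackey (R : realType) (X : tvsType R) : Type := dual X.

HB.instance Definition _ (R : realType) (X : tvsType R) :=
  GRing.Lmodule.on (@mackey R X).

Definition mackey_nbhs (R : realType) (X : tvsType R) (phi : mackey X) :
  set_system (mackey X) :=
  [set A | exists2 K : set X, mackey_gauge K &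
    [set phi + psi | psi in @polar R X K] `<=` A].

HB.instance Definition _ (R : realType) (X : tvsType R) :=
  hasNbhs.Build (@mackey R X) (@mackey_nbhs R X).

Section mackey_topology.
Context (R : realType) (X : tvsType R).
Implicit Types (phi psi : dual X) (K : set X).

Lemma dual_linearP phi a x y : phi (a *: x + y) = a * phi x + phi y.
Proof. by have /asboolP[l _] := dual_funP phi; rewrite l. Qed.

Lemma dual_continuous phi : continuous phi.
Proof. by have /asboolP[] := dual_funP phi. Qed.

Lemma dual0 phi : phi 0 = 0.
Proof.
have := dual_linearP phi 1 0 0; rewrite scale1r addr0 mul1r => h.
by apply: (addrI (phi 0)); rewrite addr0.
Qed.

Lemma dualD phi x y : phi (x + y) = phi x + phi y.
Proof. by rewrite -[x]scale1r dual_linearP mul1r scale1r. Qed.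

Lemma dualZ phi a x : phi (a *: x) = a * phi x.
Proof. by rewrite -[a *: x]addr0 dual_linearP dual0 addr0. Qed.

Lemma weak_continuous_dual phi : continuous (phi : weak X -> R^o).
Proof.
move=> x; have /cvg_sup/(_ phi) := @cvg_refl _ (nbhs (x : weak X)).
move=> h; apply: cvg_trans.
  exact: (@cvg_app _ _ _ _ (dual_fun phi) h).
exact: (@initial_continuous _ _ (phi : X -> R^o)).
Qed.

Lemma continuous_weak (T : topologicalType) (g : T -> weak X) :
  (forall phi, continuous (fun t => (phi (g t) : R^o))) -> continuous g.
Proof.
move=> cg t; apply/cvg_sup => phi.
exact: (@continuous_comp_initial _ _ _ (phi : X -> R^o) g (cg phi) t).
Qed.

Lemma polarP K phi : polar K phi <-> forall x, K x -> phi x <= 1.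
Proof.
split=> [h x Kx|h].
  rewrite -lee_fin; apply: (le_trans _ h); apply: ereal_sup_ubound.
  by exists x.
by apply: ge_ereal_sup => _ [x Kx <-]; rewrite lee_fin; exact: h.
Qed.

Lemma mackey_gauge_set1 : mackey_gauge [set (0 : X)].
Proof.
split; first exact: compact_set1.
  by move=> a x _ /= ->; rewrite scaler0.
move=> x y l; move=> /set_mem -> /set_mem ->; rewrite convmm.
exact/mem_set.
Qed.

Lemma mackey_gauge_add K L : mackey_gauge K -> mackey_gauge L ->
  mackey_gauge [set x + y | x in K & y in L].
Proof.
move=> [cK bK vK] [cL bL vL]; split.
- have -> : [set x + y | x in K & y in L] =
      (fun p : weak X * weak X => (p.1 : X) + p.2 : weak X) @`
        ((K : set (weak X)) `*` (L : set (weak X))).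
    apply/seteqP; split=> z.
      by move=> [x Kx [y Ly <-]]; exists (x, y).
    by move=> [[x y] [/= Kx Ly] <-]; exists x => //; exists y.
  apply: (@continuous_compact (weak X * weak X)%type (weak X)); last first.
    exact: (@compact_setX (weak X) (weak X) K L cK cL).
  apply: continuous_subspaceT; apply: continuous_weak => phi.
  have -> : (fun p : weak X * weak X => phi ((p.1 : X) + p.2) : R^o) =
      (fun p => phi p.1 + phi p.2) by apply/funext => p; exact: dualD.
  move=> p; apply: cvgD.
    by apply: continuous_comp; [exact: cvg_fst|exact: weak_continuous_dual].
  by apply: continuous_comp; [exact: cvg_snd|exact: weak_continuous_dual].
- move=> a _ a1 [x Kx [y Ly <-]]; rewrite scalerDr.
  by exists (a *: x); [exact: bK|exists (a *: y) => //; exact: bL].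
- move=> _ _ l /set_mem[x1 K1 [y1 L1 <-]] /set_mem[x2 K2 [y2 L2 <-]].
  have /set_mem K3 := vK _ _ l (mem_set K1) (mem_set K2).
  have /set_mem L3 := vL _ _ l (mem_set L1) (mem_set L2).
  apply/mem_set.
  exists (conv l (x1 : convex_lmodType X) x2) => //.
  exists (conv l (y1 : convex_lmodType X) y2) => //.
  by rewrite /conv /= !scalerDr addrACA.
Qed.

Lemma mackey_gauge_scale a K : mackey_gauge K ->
  mackey_gauge [set a *: x | x in K].
Proof.
move=> [cK bK vK]; split.
- apply: (@continuous_compact _ _ (fun x : weak X => a *: (x : X) : weak X)).
    apply: continuous_subspaceT; apply: continuous_weak => phi.
    have -> : (fun x : weak X => phi (a *: (x : X)) : R^o) =
        (fun x => a *: (phi x : R^o)) by apply/funext => x; exact: dualZ.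
    move=> x; apply: (@continuous_comp (weak X) R^o R^o phi ( *:%R a)).
      exact: weak_continuous_dual.
    exact: scaler_continuous.
  exact: cK.
- move=> b _ b1 [x Kx <-]; exists (b *: x); first exact: bK.
  by rewrite !scalerA mulrC.
- move=> _ _ l /set_mem[x1 K1 <-] /set_mem[x2 K2 <-].
  have /set_mem K3 := vK _ _ l (mem_set K1) (mem_set K2).
  apply/mem_set.
  exists (conv l (x1 : convex_lmodType X) x2) => //.
  by rewrite /conv /= !scalerDr !scalerA !(mulrC a).
Qed.

Lemma circled0 K : circled K -> K !=set0 -> K 0.
Proof. by move=> bK [x Kx]; rewrite -(scale0r x); apply: bK; rewrite ?normr0. Qed.

Lemma mackey_nbhs_proper (phi : mackey X) : ProperFilter (mackey_nbhs phi).
Proof.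
apply: Build_ProperFilter_ex => [A [K _ KA]|].
  exists phi; apply: KA; exists 0; last by rewrite addr0.
  by apply/polarP => x _; exact: ler01.
split.
- by exists [set 0] => //; exact: mackey_gauge_set1.
- move=> A B [K gK KA] [L gL LB].
  have p0 (M : set X) : M = set0 -> polar M = setT.
    by move=> ->; apply/seteqP; split=> // psi _; apply/polarP.
  have [K0|/set0P/circled0 K0] := eqVneq K set0.
    exists L => // _ [psi Lpsi <-]; split; last by apply: LB; exists psi.
    by apply: KA; exists psi => //; rewrite p0.
  have [L0|/set0P/circled0 L0] := eqVneq L set0.
    exists K => // _ [psi Kpsi <-]; split; first by apply: KA; exists psi.
    by apply: LB; exists psi => //; rewrite p0.
  have {}K0 : K 0 by case: gK => _ /K0.
  have {}L0 : L 0 by case: gL => _ /L0.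
  exists [set x + y | x in K & y in L]; first exact: mackey_gauge_add.
  move=> _ [psi /polarP hpsi <-]; split.
    apply: KA; exists psi => //; apply/polarP => x Kx; apply: hpsi.
    by exists x => //; exists 0 => //; rewrite addr0.
  apply: LB; exists psi => //; apply/polarP => y Ly; apply: hpsi.
  by exists 0 => //; exists y => //; rewrite add0r.
- by move=> A B AB [K gK KA]; exists K => //; exact: subset_trans AB.
Qed.

Lemma mackey_nbhs_singleton (phi : mackey X) (A : set (mackey X)) :
  mackey_nbhs phi A -> A phi.
Proof.
move=> [K _]; apply; exists 0; last by rewrite addr0.
by apply/polarP => x _; exact: ler01.
Qed.

Lemma mackey_nbhs_nbhs (phi : mackey X) (A : set (mackey X)) :
  mackey_nbhs phi A -> mackey_nbhs phi [set psi | mackey_nbhs psi A].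
Proof.
move=> [K gK KA]; exists [set 2 *: x | x in K].
  exact: mackey_gauge_scale.
move=> _ [psi /polarP h <-]; exists [set 2 *: x | x in K].
  exact: mackey_gauge_scale.
move=> _ [xi /polarP h' <-]; apply: KA; exists (psi + xi); last first.
  by rewrite addrA.
apply/polarP => x Kx.
have := h (2 *: x); rewrite dualZ => /(_ (imageP _ Kx)) h1.
have := h' (2 *: x); rewrite dualZ => /(_ (imageP _ Kx)) h2.
have -> : (psi + xi : dual X) x = psi x + xi x by [].
by move: h1 h2; lra.
Qed.

HB.instance Definition _ := Nbhs_isNbhsTopological.Build (mackey X)
  mackey_nbhs_proper mackey_nbhs_singleton mackey_nbhs_nbhs.

End mackey_topology.

Definition edom (T : Type) (R : realType) (g : T -> \bar R) : set T :=
  [set x | (g x < +oo)%E].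

(* Properness of a function valued in R u {+oo}. *)
Definition proper_fun (T : Type) (R : realType) (g : T -> \bar R) : Prop :=
  (forall x, (-oo < g x)%E) /\ edom g !=set0.

(* [f - phi] attains its minimum. *)
Definition attains_min_sub (R : realType) (X : tvsType R) (f : X -> \bar R)
    (phi : X -> R) : Prop :=
  exists x, f x \is a fin_num /\
    forall y, (f x - (phi x)%:E <= f y - (phi y)%:E)%E.

Definition conjugate (R : realType) (X : tvsType R) (f : X -> \bar R)
    (phi : mackey X) : \bar R :=
  ereal_sup [set ((phi x)%:E - f x)%E | x in [set: X]].

Definition epi_pointed (R : realType) (X : tvsType R) (f : X -> \bar R) :
    Prop :=
  proper_fun (conjugate f) /\
  exists phi : mackey X, edom (conjugate f) phi /\
    {for phi, continuous (conjugate f)}.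

(* Main.v *)
(* A weak limit point of a sublevel set which is not in X yields, X being
   complete, a gap on some equicontinuous set V°. Since U contains a translate of
   the polar of a weakly compact convex K, the gap can be multiplied at will while
   staying in the polar of K: Hahn-Banach gives forms [phi n], small on K, and
   points [xs k] of the sublevel set with [phi n (xs k) >= 1] for [k >= n] and
   [phi n (xs k)] small for [k < n]. James's construction, in the form given to it
   by Pryce, then builds from the [phi n] a form which lies in the polar of K and
   for which the minimum is not attained. For the second part f is replaced by
   the supremum of its affine minorants with slope in U, whose minima over U are
   attained at the same points and whose sublevel sets are convex; the
   difference set L - L of such a sublevel set is weakly compact, convex and
   circled, and its polar controls the conjugate. *)
Require Import Defs.
From HB Require Import structures.
From mathcomp Require Import all_boot all_order all_algebra.
From mathcomp Require Import ring lra.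
From mathcomp Require Import all_classical all_reals all_analysis.
Import Order.TTheory GRing.Theory Num.Theory.
Import numFieldNormedType.Exports.
Local Open Scope classical_set_scope.
Local Open Scope ring_scope.

Set Implicit Arguments.
Unset Strict Implicit.
Unset Printing Implicit Defensive.

(** * Sublinear functionals *)

Section hahn_banach.
Context {R : realType} {V : lmodType R}.
Implicit Types (p q f : V -> R) (B : set V).

Definition sublinear p : Prop :=
  (forall x y, p (x + y) <= p x + p y) /\
  (forall a x, 0 <= a -> p (a *: x) = a * p x).

Definition linear_form f : Prop :=
  (forall x y, f (x + y) = f x + f y) /\ (forall a x, f (a *: x) = a * f x).

Definition convex_subset B : Prop := forall x y s,
  B x -> B y -> 0 <= s <= 1 -> B (s *: x + (1 - s) *: y).

Lemma sublinear0 p : sublinear p -> p 0 = 0.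
Proof. by case=> _ hp; rewrite -(scale0r 0) hp// mul0r. Qed.

Lemma sublinearN p x : sublinear p -> - p (- x) <= p x.
Proof.
move=> hp; have := hp.1 x (- x); rewrite subrr (sublinear0 hp); lra.
Qed.

Lemma linear_form0 f : linear_form f -> f 0 = 0.
Proof. by case=> _ hf; rewrite -(scale0r 0) hf mul0r. Qed.

Lemma linear_formN f x : linear_form f -> f (- x) = - f x.
Proof. by case=> _ hf; rewrite -scaleN1r hf mulN1r. Qed.

Lemma linear_formB f x y : linear_form f -> f (x - y) = f x - f y.
Proof. by move=> lf; rewrite lf.1 linear_formN. Qed.

Lemma linear_formD f g : linear_form f -> linear_form g ->
  linear_form (fun x => f x + g x).
Proof.
move=> [fD fZ] [gD gZ]; split=> [x y|a x]; first by rewrite fD gD; ring.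
by rewrite fZ gZ; ring.
Qed.

Lemma linear_formZ a f : linear_form f -> linear_form (fun x => a * f x).
Proof.
move=> [fD fZ]; split=> [x y|b x]; first by rewrite fD; ring.
by rewrite fZ; ring.
Qed.

Definition tilt p B (c : R) (x : V) : R :=
  inf [set v | exists t b, [/\ 0 <= t, B b & v = p (x + t *: b) - t * c]].

Section tilt.
Context p B (c : R).
Hypotheses (sp : sublinear p) (B0 : B !=set0) (cB : convex_subset B)
  (pB : forall b, B b -> c <= p b).

Let S x := [set v | exists t b, [/\ 0 <= t, B b & v = p (x + t *: b) - t * c]].

Let S_lb x : lbound (S x) (- p (- x)).
Proof.
move=> _ [t [b [t0 Bb ->]]].
have := sp.1 (x + t *: b) (- x); rewrite addrAC subrr add0r sp.2//.
have := pB Bb; nra.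
Qed.

Let S_le x t b : 0 <= t -> B b -> tilt p B c x <= p (x + t *: b) - t * c.
Proof.
move=> t0 Bb; apply: ge_inf; first by exists (- p (- x)); exact: S_lb.
by exists t, b.
Qed.

Let S_inf x : has_inf (S x).
Proof.
case: B0 => b Bb; split; last by exists (- p (- x)); exact: S_lb.
by exists (p (x + 0 *: b) - 0 * c); exists 0, b.
Qed.

Let S_ge x d : (forall t b, 0 <= t -> B b -> d <= p (x + t *: b) - t * c) ->
  d <= tilt p B c x.
Proof.
move=> h; apply: lb_le_inf; first exact: (S_inf x).1.
by move=> _ [t [b [t0 Bb ->]]]; exact: h.
Qed.

Lemma tilt_lb x t b : 0 <= t -> B b -> tilt p B c x <= p (x + t *: b) - t * c.
Proof. exact: S_le. Qed.

Lemma tilt_le x : tilt p B c x <= p x.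
Proof.
case: B0 => b Bb; have := @S_le x 0 b (lexx 0) Bb.
by rewrite scale0r addr0 mul0r subr0.
Qed.

Lemma tilt_oppr b : B b -> tilt p B c (- b) <= - c.
Proof.
move=> Bb; have := @S_le (- b) 1 b ler01 Bb.
by rewrite scale1r addNr mul1r (sublinear0 sp) sub0r.
Qed.

Lemma tilt_sublinear : sublinear (tilt p B c).
Proof.
split=> [x y|a x a0].
  rewrite -lerBlDr; apply: S_ge => t b t0 Bb.
  rewrite lerBlDr -lerBlDl; apply: S_ge => t' b' t'0 Bb'.
  rewrite lerBlDl.
  have [tt0|tt0] := eqVneq (t + t') 0.
    have [-> ->] : t = 0 /\ t' = 0 by split; lra.
    rewrite !scale0r !addr0 !mul0r !subr0.
    exact: (le_trans (tilt_le _) (sp.1 _ _)).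
  have tt0' : 0 < t + t' by rewrite lt_def tt0 addr_ge0.
  pose s := t / (t + t').
  have s01 : 0 <= s <= 1.
    by rewrite /s divr_ge0 ?(ltW tt0')//= ler_pdivrMr// mul1r lerDl.
  have := @S_le (x + y) (t + t') _ (ltW tt0') (cB Bb Bb' s01).
  have -> : (t + t') *: (s *: b + (1 - s) *: b') = t *: b + t' *: b'.
    rewrite scalerDr !scalerA mulrBr mulr1 /s mulrC divfK//.
    by congr (_ + _ *: _); ring.
  rewrite addrACA => /le_trans; apply.
  by have := sp.1 (x + t *: b) (y + t' *: b'); lra.
have [->|an0] := eqVneq a 0.
  rewrite scale0r mul0r; apply/eqP; rewrite eq_le; apply/andP; split.
    by rewrite (le_trans (tilt_le _))// (sublinear0 sp).
  by apply: S_ge => t b t0 Bb; rewrite add0r sp.2//; have := pB Bb; nra.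
have {an0}a0 : 0 < a by rewrite lt_def an0.
apply/eqP; rewrite eq_le; apply/andP; split.
  rewrite mulrC -ler_pdivrMr//; apply: S_ge => t b t0 Bb.
  rewrite ler_pdivrMr//.
  have := @S_le (a *: x) (a * t) b (mulr_ge0 (ltW a0) t0) Bb.
  by rewrite -scalerA -scalerDr sp.2 ?(ltW a0)//; lra.
apply: S_ge => t b t0 Bb; rewrite -ler_pdivlMl//.
have := @S_le x (a^-1 * t) b (mulr_ge0 (ltW _) t0) Bb.
rewrite invr_gt0 => /(_ a0) /le_trans; apply.
have -> : a *: x + t *: b = a *: (x + (a^-1 * t) *: b).
  by rewrite scalerDr scalerA mulrA divff ?gt_eqF// mul1r.
by rewrite (sp.2 _ _ (ltW a0)) mulrBr !mulrA mulVf ?gt_eqF// mul1r.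
Qed.

End tilt.

(* A minimal sublinear functional is linear, since tilting it cannot make it
   smaller. *)
Lemma sublinear_dominates p : sublinear p ->
  exists2 f, linear_form f & forall x, f x <= p x.
Proof.
move=> sp.
pose T := {q : V -> R | sublinear q /\ forall x, q x <= p x}.
pose le (a b : T) := `[< forall x, sval b x <= sval a x >].
have [] := @Zorn T le.
- by move=> a; apply/asboolP.
- move=> a b c /asboolP ab /asboolP bc; apply/asboolP => x.
  exact: le_trans (bc x) (ab x).
- move=> [a ha] [b hb] /asboolP/= ab /asboolP/= ba; apply: eq_exist => /=.
  apply/funext => x.
  by apply/eqP; rewrite eq_le ba ab.
- move=> A totA.
  have [->|/set0P[a0 Aa0]] := eqVneq A set0.
    by exists (exist _ p (conj sp (fun x => lexx _))).
  pose S x := [set sval a x | a in A].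
  have Slb x : lbound (S x) (- p (- x)).
    move=> _ [a Aa <-]; have [sa ap] := svalP a.
    by apply: le_trans (sublinearN x sa); rewrite lerN2.
  have Sinf x : has_inf (S x).
    by split; [exists (sval a0 x), a0|exists (- p (- x)); exact: Slb].
  have Sle x a : A a -> inf (S x) <= sval a x.
    by move=> Aa; apply: ge_inf; [exact: (Sinf x).2|exists a].
  have Sge x c : (forall a, A a -> c <= sval a x) -> c <= inf (S x).
    by move=> h; apply: lb_le_inf; [exact: (Sinf x).1|move=> _ [a Aa <-]; exact: h].
  have sm : sublinear (fun x => inf (S x)).
    split=> [x y|r x r0].
      rewrite -lerBlDr; apply: (Sge) => a Aa.
      rewrite lerBlDr -lerBlDl; apply: (Sge) => b Ab; rewrite lerBlDl.
      have [/asboolP ab|/asboolP ba] := totA _ _ Aa Ab.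
        apply: le_trans (Sle _ _ Ab) _.
        by have := (svalP b).1.1 x y; have := ab x; lra.
      apply: le_trans (Sle _ _ Aa) _.
      by have := (svalP a).1.1 x y; have := ba y; lra.
    have [->|rn0] := eqVneq r 0.
      rewrite scale0r mul0r; apply/eqP; rewrite eq_le; apply/andP; split.
        by have := Sle 0 _ Aa0; rewrite (sublinear0 (svalP a0).1).
      by apply: (Sge) => a Aa; rewrite (sublinear0 (svalP a).1).
    have {rn0}r0 : 0 < r by rewrite lt_def rn0.
    apply/eqP; rewrite eq_le; apply/andP; split.
      rewrite mulrC -ler_pdivrMr//; apply: (Sge) => a Aa.
      rewrite ler_pdivrMr// mulrC -(svalP a).1.2 ?(ltW r0)//; exact: Sle.
    apply: (Sge) => a Aa; rewrite (svalP a).1.2 ?(ltW r0)// ler_pM2l//.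
    exact: Sle.
  have mp x : inf (S x) <= p x.
    exact: le_trans (Sle x _ Aa0) ((svalP a0).2 x).
  have mT : sublinear (fun x => inf (S x)) /\ forall x, inf (S x) <= p x by [].
  exists (exist _ (fun x => inf (S x)) mT) => a Aa; apply/asboolP => x; exact: Sle.
move=> [f [sf fp]] fmin.
have fD x y : f (x + y) = f x + f y.
  pose B := [set y].
  have cB : convex_subset B.
    by move=> _ _ s -> -> _; rewrite /B/= -scalerDl addrC subrK scale1r.
  have B0 : B !=set0 by exists y.
  have fB b : B b -> f y <= f b by move=> ->.
  have st := tilt_sublinear sf B0 cB fB.
  have tf := tilt_le sf B0 fB.
  have /(congr1 sval)/= :=
    fmin (exist _ _ (conj st (fun x => le_trans (tf x) (fp x)))) (asboolT tf).
  move=> fE; apply/eqP; rewrite eq_le sf.1/=.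
  have := tilt_lb sf fB x ler01 (erefl y : B y).
  by rewrite fE scale1r mul1r lerBrDr.
have fN x : f (- x) = - f x.
  by apply/eqP; rewrite -addr_eq0 -fD addNr (sublinear0 sf).
exists f => //; split=> // a x.
have [a0|a0] := leP 0 a; first exact: sf.2.
by rewrite -[a]opprK scaleNr fN sf.2 ?mulNr// oppr_ge0 ltW.
Qed.

Lemma sublinear_separation p B c : sublinear p -> B !=set0 ->
  convex_subset B -> (forall b, B b -> c <= p b) ->
  exists f, [/\ linear_form f, forall x, f x <= p x & forall b, B b -> c <= f b].
Proof.
move=> sp B0 cB pB.
have [f lf ft] := sublinear_dominates (tilt_sublinear sp B0 cB pB).
exists f; split=> // [x|b Bb]; first exact: le_trans (ft x) (tilt_le sp B0 pB x).
rewrite -lerN2 -linear_formN//.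
exact: le_trans (ft _) (tilt_oppr sp pB Bb).
Qed.

Lemma sublinear_norming p x : sublinear p ->
  exists f, [/\ linear_form f, forall y, f y <= p y & f x = p x].
Proof.
move=> sp.
have [| |y -> //|f [lf fp fx]] := @sublinear_separation p [set x] (p x) sp.
- by exists x.
- by move=> _ _ s -> -> _; rewrite /= -scalerDl addrC subrK scale1r.
by exists f; split=> //; apply/eqP; rewrite eq_le fp fx.
Qed.

(* A Banach limit: apply Hahn-Banach to the upper limit. *)
Lemma generalized_limit (a : nat -> V -> R) :
  (forall n, linear_form (a n)) ->
  (forall x, exists M, forall n, a n x <= M) ->
  exists2 f, linear_form f &
    forall x c, (exists N, forall n, (N <= n)%N -> a n x <= c) -> f x <= c.
Proof.
move=> la ba.
pose S x := [set c | exists N, forall n, (N <= n)%N -> a n x <= c].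
have Slb x : has_lbound (S x).
  have [M hM] := ba (- x); exists (- M) => c [N hN].
  by have := hM N; rewrite linear_formN//; have := hN N (leqnn _); lra.
have S0 x : S x !=set0 by have [M hM] := ba x; exists M, 0%N.
have Sle x c : S x c -> inf (S x) <= c by move=> h; apply: ge_inf.
have SZ r x c : 0 <= r -> S x c -> S (r *: x) (r * c).
  by move=> r0 [N hN]; exists N => n /hN ?; rewrite (la n).2 ler_wpM2l.
have sS : sublinear (fun x => inf (S x)).
  split=> [x y|r x r0].
    rewrite -lerBlDr; apply: lb_le_inf => // c [N hN].
    rewrite lerBlDr -lerBlDl; apply: lb_le_inf => // d [N' hN'].
    rewrite lerBlDl; apply: (Sle); exists (maxn N N') => n.
    rewrite geq_max => /andP[/hN ? /hN' ?]; rewrite (la n).1; lra.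
  have [->|rn0] := eqVneq r 0.
    rewrite scale0r mul0r; apply/eqP; rewrite eq_le; apply/andP; split.
      by apply: (Sle); exists 0%N => n _; rewrite linear_form0.
    apply: lb_le_inf => // c [N /(_ N (leqnn _))].
    by rewrite linear_form0.
  have {rn0}r0 : 0 < r by rewrite lt_def rn0.
  apply/eqP; rewrite eq_le; apply/andP; split.
    rewrite mulrC -ler_pdivrMr//; apply: lb_le_inf => // c hc.
    by rewrite ler_pdivrMr// mulrC; apply: (Sle); apply: (SZ) => //; exact: ltW.
  apply: lb_le_inf => // c hc; rewrite -ler_pdivlMl//.
  apply: (Sle); have ri : 0 <= r^-1 by rewrite invr_ge0 ltW.
  by have := SZ _ _ _ ri hc; rewrite scalerA mulVf ?gt_eqF// scale1r.
have [f lf fS] := sublinear_dominates sS.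
by exists f => // x c hc; apply: le_trans (fS x) (Sle _ _ hc).
Qed.

End hahn_banach.

(** * Sequences of linear forms *)

Lemma dependent_choice_nat (T : Type) (P : nat -> T -> Prop)
    (Q : nat -> T -> T -> Prop) (t0 : T) :
  P 0%N t0 -> (forall n t, P n t -> exists t', P n.+1 t' /\ Q n t t') ->
  exists u : nat -> T,
    [/\ u 0%N = t0, forall n, P n (u n) & forall n, Q n (u n) (u n.+1)].
Proof.
move=> P0 step.
have step' n (s : {t | P n t}) : {t' | P n.+1 t' /\ Q n (sval s) t'}.
  by apply: cid; apply: step; exact: svalP.
pose fix u n : {t | P n t} := match n with
  | 0%N => exist _ t0 P0
  | m.+1 => let t := step' m (u m) in exist _ (sval t) (svalP t).1
  end.
exists (fun n => sval (u n)); split=> // n; first exact: svalP.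
by rewrite /=; exact: (svalP (step' n (u n))).2.
Qed.

Section generalized_limit_scaled.
Context {R : realType} {V : lmodType R}.
Variables (a : nat -> V -> R) (f : V -> R).
Hypotheses (la : forall n, linear_form (a n)) (lf : linear_form f).
Hypothesis lim : forall x c,
  (exists N, forall n, (N <= n)%N -> a n x <= c) -> f x <= c.

Lemma generalized_limit_leM x b c :
  (exists N, forall n, (N <= n)%N -> b * a n x <= c) -> b * f x <= c.
Proof.
move=> [N hN]; rewrite -lf.2; apply: lim.
by exists N => n /hN; rewrite (la n).2.
Qed.

Lemma generalized_limit_geM x b c :
  (exists N, forall n, (N <= n)%N -> c <= b * a n x) -> c <= b * f x.
Proof.
move=> [N hN]; rewrite -lerN2 -mulNr; apply: generalized_limit_leM.
by exists N => n /hN ?; rewrite mulNr lerN2.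
Qed.

End generalized_limit_scaled.

Section coercivity.
Context {R : realType} {V : lmodType R}.
Variables (q : V -> R) (Y : set V) (h : V -> R).
Hypotheses (sq : sublinear q) (qN : forall x, q (- x) = q x).

Lemma seminorm_ge0 x : 0 <= q x.
Proof. by have := sublinearN x sq; rewrite qN; lra. Qed.

Lemma seminorm_bound f c x : linear_form f ->
  (forall x, f x <= c * q x) -> `|f x| <= c * q x.
Proof.
move=> lf fq; rewrite ler_norml fq andbT lerNl -linear_formN// -qN.
exact: fq.
Qed.

(* A gliding hump: around every form bounded by [q / 2] the conjugate of [h]
   is unbounded at arbitrarily small distance, so a series of forms can be built
   along which it is infinite. *)
Lemma coercive_of_bounded_conjugate :
  (forall f, linear_form f -> (forall x, f x <= q x) ->
     exists M, forall x, Y x -> f x - h x <= M) ->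
  exists t M, 0 < t /\ forall x, Y x -> t * q x - M <= h x.
Proof.
move=> bnd; apply: contrapT => ncoer.
have nc t M : 0 < t -> exists2 x, Y x & h x < t * q x - M.
  move=> t0; apply: contrapT => nx; apply: ncoer; exists t, M; split=> // x Yx.
  by rewrite leNgt; apply/negP => hx; apply: nx; exists x.
have unb S t M : linear_form S -> (forall x, S x <= q x) -> 0 < t ->
    exists2 x, Y x & M < S x + t * q x - h x.
  move=> lS Sq t0; have lS' := linear_formZ (-1) lS.
  have [|M' hM'] := bnd _ lS'.
    by move=> x; rewrite mulN1r -linear_formN// -(qN x).
  have [x Yx hx] := nc (t / 2) ((M + M') / 2) (divr_gt0 t0 (ltr0Sn _ 1)).
  exists x => //; have := hM' x Yx; lra.
pose P (n : nat) (s : (V -> R) * R) := [/\ linear_form s.1, 0 < s.2, s.2 <= 1 &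
  forall x, s.1 x <= (1 - 2 * s.2) * q x].
pose Q (n : nat) (s s' : (V -> R) * R) := s'.2 <= s.2 / 2 /\
  (forall x, `|s'.1 x - s.1 x| <= s.2 * q x) /\
  exists x, [/\ Y x, n%:R < s'.1 x - h x & 2 * s'.2 * q x <= 1].
have [| |u [u0 uP uQ]] := @dependent_choice_nat _ P Q (fun=> 0, 1 / 2).
- split=> /=; [|lra|lra|]; last first.
    by move=> x; rewrite (_ : 1 - 2 * (1 / 2) = 0) ?mul0r//; lra.
  by split=> *; rewrite ?mulr0 ?addr0.
- move=> n [S t] [/= lS t0 t1 Sq].
  have [|x Yx hx] := unb S t n%:R lS _ t0.
    by move=> x; have := Sq x; have := seminorm_ge0 x; nra.
  have [f [lf fq fx]] := sublinear_norming x sq.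
  have qx := seminorm_ge0 x.
  have q1 : 0 < 2 * (1 + q x) by nra.
  pose t' := t / (2 * (1 + q x)).
  have t'E : t' * (2 * (1 + q x)) = t by rewrite divfK// gt_eqF.
  have t'0 : 0 < t' by rewrite divr_gt0.
  exists (fun x => S x + t * f x, t'); split; [split=> //=|split=> /=].
  + by apply: linear_formD => //; exact: linear_formZ.
  + by nra.
  + move=> y; have := Sq y; have := fq y; have := seminorm_ge0 y.
    have : 2 * t' <= t by nra.
    nra.
  + by rewrite ler_pdivlMr//; nra.
  + split; last by exists x; split=> //; [rewrite fx; lra|nra].
    move=> y; rewrite addrAC subrr add0r normrM gtr0_norm// ler_pM2l//.
    by rewrite -[q y]mul1r; apply: seminorm_bound => // z; rewrite mul1r.
have ul n : linear_form (u n).1 by case: (uP n).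
have udist n j x : `|(u (n + j)%N).1 x - (u n).1 x| <=
    2 * ((u n).2 - (u (n + j)%N).2) * q x.
  elim: j => [|j IH]; first by rewrite addn0 !subrr normr0 mulr0 mul0r.
  rewrite addnS; have [ht [/(_ x) hd _]] := uQ (n + j)%N.
  have := ler_normD ((u (n + j).+1).1 x - (u (n + j)%N).1 x)
    ((u (n + j)%N).1 x - (u n).1 x).
  rewrite addrA subrK => /le_trans; apply.
  have := seminorm_ge0 x; nra.
have [|f lf flim] := @generalized_limit _ _ (fun n => (u n).1) ul.
  move=> x; exists (q x) => n; have [_ t0 t1 /(_ x)] := uP n.
  by have := seminorm_ge0 x; nra.
have fq x : f x <= q x.
  apply: flim; exists 0%N => n _; have [_ t0 t1 /(_ x)] := uP n.
  by have := seminorm_ge0 x; nra.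
have [M hM] := bnd f lf fq.
pose n := (Num.truncn `|M + 1|).+1.
have nM : M + 1 < n%:R.
  by apply: le_lt_trans (ler_norm _) _; rewrite truncnS_gt.
have [_ [_ [x [Yx hx qx]]]] := uQ n.
have : (u n.+1).1 x - 1 <= 1 * f x.
  apply: (generalized_limit_geM ul lf flim); exists n.+1 => k nk.
  have := udist n.+1 (k - n.+1)%N x; rewrite subnKC// ler_norml => /andP[+ _].
  have [_ t0 _ _] := uP k; have := seminorm_ge0 x; nra.
by have := hM x Yx; lra.
Qed.

End coercivity.

(** * James's construction *)

Section james.
Context {R : realType} {V : lmodType R}.
Variables (q : V -> R) (Y : set V) (h : V -> R) (phi : nat -> V -> R).
Hypotheses (sq : sublinear q) (qN : forall x, q (- x) = q x).
Hypotheses (lphi : forall n, linear_form (phi n))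
  (phiq : forall n x, phi n x <= q x).
Implicit Types (E : set nat) (F v : V -> R) (b c d : R).

Inductive hull E : (V -> R) -> Prop :=
| hull_base k : E k -> hull E (phi k)
| hull_comb u v s : hull E u -> hull E v -> 0 <= s <= 1 ->
    hull E (fun x => s * u x + (1 - s) * v x).

Lemma hull_subset E E' v : E `<=` E' -> hull E v -> hull E' v.
Proof.
move=> EE'; elim=> [k /EE'|]; first exact: hull_base.
by move=> u w s _ hu _ hw; exact: hull_comb.
Qed.

Lemma hull_linear E v : hull E v -> linear_form v.
Proof.
elim=> [k _|u w s _ hu _ hw _]; first exact: lphi.
by apply: linear_formD; exact: linear_formZ.
Qed.

Lemma hull_leM E v b c x :
  (forall k, E k -> b * phi k x <= c) -> hull E v -> b * v x <= c.
Proof.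
move=> hE; elim=> [k /hE//|u w s _ hu _ hw /andP[s0 s1]]; nra.
Qed.

Lemma hull_le E v x : hull E v -> v x <= q x.
Proof.
move=> hv; rewrite -[v x]mul1r; apply: hull_leM hv => k _.
by rewrite mul1r.
Qed.

Definition unbounded E := forall N, exists2 k, (N <= k)%N & E k.

Lemma unbounded_from E N : unbounded E -> unbounded (E `&` [set k | (N <= k)%N]).
Proof.
move=> uE M; have [k] := uE (maxn N M).
by rewrite geq_max => /andP[Nk Mk] Ek; exists k.
Qed.

(* Essentially [F - b * liminf_E phi - h <= c] on [Y]. *)
Definition upper_bound E F b c := forall x, Y x ->
  exists N, forall k, (N <= k)%N -> E k -> F x - b * phi k x - h x <= c.

Lemma upper_bound_subset E E' F b c : E' `<=` E ->
  upper_bound E F b c -> upper_bound E' F b c.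
Proof.
by move=> EE' hE x /hE[N hN]; exists N => k Nk /EE'; exact: hN.
Qed.

Lemma upper_bound_convex E F F' b b' c c' s : 0 <= s <= 1 ->
  upper_bound E F b c -> upper_bound E F' b' c' ->
  upper_bound E (fun x => s * F x + (1 - s) * F' x) (s * b + (1 - s) * b')
    (s * c + (1 - s) * c').
Proof.
move=> /andP[s0 s1] hF hF' x Yx; have [N hN] := hF x Yx.
have [N' hN'] := hF' x Yx; exists (maxn N N') => k.
rewrite geq_max => /andP[Nk N'k] Ek.
have := hN k Nk Ek; have := hN' k N'k Ek; nra.
Qed.

Lemma not_upper_bound E F b c : ~ upper_bound E F b c ->
  exists2 x, Y x & unbounded [set k | E k /\ c < F x - b * phi k x - h x].
Proof.
move=> nub; apply: contrapT => nx; apply: nub => x Yx.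
apply: contrapT => nN; apply: nx; exists x => // N.
apply: contrapT => nk; apply: nN; exists N => k Nk Ek.
by rewrite leNgt; apply/negP => hk; apply: nk; exists k.
Qed.

Variable rad : R.
Hypothesis attains : forall G, linear_form G -> (forall x, G x <= rad * q x) ->
  exists2 u, Y u & forall x, Y x -> G x - h x <= G u - h u.

Let q0 := seminorm_ge0 sq qN.

Lemma formB_le F v b d x : linear_form F -> linear_form v -> 0 <= b ->
  (forall x, F x <= d * q x) -> (forall x, v x <= q x) ->
  F x - b * v x <= (d + b) * q x.
Proof.
move=> lF lv b0 Fd vq; have := Fd x; have := vq (- x).
rewrite qN linear_formN//; nra.
Qed.

(* Otherwise pinning points with larger and larger values along smaller and
   smaller [E] yields a limit form at which the conjugate of [h] is infinite. *)
Lemma upper_bound_exists E F b d : unbounded E -> linear_form F -> 0 <= b ->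
  (forall x, F x <= d * q x) -> d + b <= rad ->
  exists E' c, [/\ E' `<=` E, unbounded E' & upper_bound E' F b c].
Proof.
move=> uE lF b0 Fd dbr; apply: contrapT => nE.
pose P (n : nat) E' := E' `<=` E /\ unbounded E'.
pose Q (n : nat) E1 E2 := E2 `<=` E1 /\
  exists2 x, Y x & forall k, E2 k -> n%:R < F x - b * phi k x - h x.
have [|| u [u0 uP uQ]] := @dependent_choice_nat _ P Q E; first by split.
  move=> n E1 [E1E uE1].
  have [|x Yx uE2] := @not_upper_bound E1 F b n%:R.
    by move=> ub; apply: nE; exists E1, n%:R.
  exists [set k | E1 k /\ n%:R < F x - b * phi k x - h x].
  split; first by split=> // k [/E1E].
  by split=> [k []//|]; exists x => // k [].
have /choice[k hk] n : exists k, u n k.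
  by have [_ /(_ 0%N)[j _ uj]] := uP n; exists j.
have umono n m : (n <= m)%N -> u m `<=` u n.
  elim: m => [|m IH]; first by rewrite leqn0 => /eqP ->.
  rewrite leq_eqVlt => /predU1P[->//|/IH]; apply: subset_trans.
  by have [] := uQ m.
pose a n x := F x - b * phi (k n) x.
have la n : linear_form (a n).
  have -> : a n = fun x => F x + (- b) * phi (k n) x.
    by apply/funext => x; rewrite mulNr.
  by apply: linear_formD => //; exact: linear_formZ.
have aq n x : a n x <= rad * q x.
  apply: le_trans (formB_le x lF (lphi (k n)) b0 Fd (phiq (k n))) _.
  by rewrite ler_wpM2r.
have [|G lG limG] := generalized_limit la.
  by move=> x; exists (rad * q x) => n.
have [|v Yv hv] := attains lG.
  by move=> x; apply: limG; exists 0%N => n _.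
pose n := (Num.truncn `|G v - h v|).+1.
have nM : G v - h v < n%:R.
  by apply: le_lt_trans (ler_norm _) _; rewrite truncnS_gt.
have [_ [x Yx hx]] := uQ n.
have : n%:R + h x <= 1 * G x.
  apply: (generalized_limit_geM la lG limG); exists n.+1 => j nj.
  have := hx _ (umono _ _ nj _ (hk j)); rewrite /a; lra.
by have := hv x Yx; lra.
Qed.

Definition steep E F b c beta alpha := forall E' v d, E' `<=` E -> unbounded E' ->
  hull E v -> upper_bound E' (fun x => F x + beta * v x) (b + beta) d ->
  c + beta * alpha <= d.

(* The new form is chosen nearly minimal among all refinements of [E], so that
   by convexity steepness is inherited, at the cost of lowering the slope. *)
Lemma steep_step E F b c beta alpha beta' alpha' N :
  unbounded E -> linear_form F -> (forall x, F x <= b * q x) ->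
  0 <= b -> 0 < beta -> 0 < beta' -> alpha' < alpha -> 2 * (b + beta) <= rad ->
  upper_bound E F b c -> steep E F b c beta alpha ->
  exists E' v c', let F' := fun x => F x + beta * v x in
    [/\ E' `<=` E, forall k, E' k -> (N <= k)%N, unbounded E' & hull E v] /\
    [/\ upper_bound E' F' (b + beta) c', c + beta * alpha <= c',
        steep E' F' (b + beta) c' beta' alpha' &
        exists2 x, Y x & forall k, E' k ->
          c' - 2 * (beta' * (alpha - alpha')) < F' x - (b + beta) * phi k x - h x].
Proof.
move=> uE lF Fb b0 be0 be'0 aa rad2 ubE stE.
pose D := [set d | exists E' v, [/\ E' `<=` E, unbounded E', hull E v &
  upper_bound E' (fun x => F x + beta * v x) (b + beta) d]].
have Dlb : lbound D (c + beta * alpha).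
  by move=> d [E' [v [E'E uE' hv ub]]]; exact: (stE E' v d).
have D0 : D !=set0.
  have [k _ Ek] := uE 0%N.
  have [||||E' [d [E'E uE' ub]]] :=
    @upper_bound_exists E (fun x => F x + beta * phi k x) (b + beta) (b + beta) uE.
  - by apply: linear_formD => //; exact: linear_formZ.
  - by lra.
  - by move=> x; have := Fb x; have := phiq k x; nra.
  - by lra.
  by exists d, E', (phi k); split=> //; exact: hull_base.
have hD : has_inf D by split=> //; exists (c + beta * alpha).
pose del := beta' * (alpha - alpha').
have del0 : 0 < del by rewrite mulr_gt0// subr_gt0.
have [d [E1 [v [E1E uE1 hv ubd]]] dD] := inf_adherent del0 hD.
have infD : c + beta * alpha <= inf D by exact: lb_le_inf.
have infDle d' : D d' -> inf D <= d' by move=> Dd'; apply: ge_inf => //; exact: hD.2.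
have infd : inf D <= d by apply: (infDle); exists E1, v.
have [ub|x Yx uE2] := @not_upper_bound E1 (fun x => F x + beta * v x) (b + beta)
  (inf D - del).
  have : inf D <= inf D - del by apply: (infDle); exists E1, v.
  by lra.
pose E2 :=
  [set k | E1 k /\ inf D - del < F x + beta * v x - (b + beta) * phi k x - h x] `&`
  [set k | (N <= k)%N].
have E21 : E2 `<=` E1 by move=> k [[]].
have E2E : E2 `<=` E by exact: subset_trans E1E.
exists E2, v, d; split.
  by split=> // [k []//|]; exact: unbounded_from.
split; [exact: upper_bound_subset ubd|by lra| |]; last first.
  by exists x => // k [[_ hk] _]; rewrite -/del; lra.
move=> E' w e E'E2 uE' hw ube.
pose s := beta' / (beta + beta').
have bb0 : 0 < beta + beta' by lra.
have sE : s * (beta + beta') = beta' by rewrite divfK// gt_eqF.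
have s0 : 0 <= s by rewrite divr_ge0// ltW.
have s1 : s <= 1 by rewrite ler_pdivrMr//; lra.
have s01 : 0 <= s <= 1 by rewrite s0.
have := upper_bound_convex s01 (upper_bound_subset (subset_trans E'E2 E2E) ubE) ube.
have -> : s * b + (1 - s) * (b + beta + beta') = b + beta.
  rewrite [X in _ = X](_ : _ = b + (beta + beta') - s * (beta + beta')); last lra.
  by ring.
have -> : (fun x => s * F x + (1 - s) * (F x + beta * v x + beta' * w x)) =
    (fun x => F x + beta * (s * w x + (1 - s) * v x)).
  apply/funext => y; apply/eqP; rewrite -subr_eq0; apply/eqP.
  rewrite [LHS](_ : _ = (w y) * (beta' - s * (beta + beta'))); last by ring.
  by rewrite sE subrr mulr0.
move=> ub'; have : inf D <= s * c + (1 - s) * e.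
  apply: (infDle); exists E', (fun x => s * w x + (1 - s) * v x); split=> //.
    exact: subset_trans E2E.
  by apply: hull_comb => //; exact: hull_subset hw.
have sb : 1 - s = beta / (beta + beta').
  by rewrite /s; field; rewrite gt_eqF.
rewrite sb /s -(ler_pM2l bb0) => h1.
have h2 : (beta + beta') * (beta' / (beta + beta') * c + beta / (beta + beta') * e) =
  beta' * c + beta * e by field; rewrite gt_eqF.
rewrite h2 in h1.
have h3 : beta * (inf D + beta' * alpha) <= beta * e.
  have : beta' * (c + beta * alpha) <= beta' * inf D by rewrite ler_pM2l.
  lra.
rewrite ler_pM2l// in h3.
by move: dD; rewrite /del; lra.
Qed.


Lemma hull_eventually_ge v (xs : nat -> V) :
  (forall n k, (n <= k)%N -> 1 <= phi n (xs k)) ->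
  hull setT v -> exists N, forall k, (N <= k)%N -> 1 <= v (xs k).
Proof.
move=> h1; elim=> [k _|u w s _ [N hN] _ [N' hN'] /andP[s0 s1]].
  by exists k => j; exact: h1.
exists (maxn N N') => k; rewrite geq_max => /andP[/hN ? /hN' ?]; nra.
Qed.

Variables (xs : nat -> V) (gamma m B : R).
Hypotheses (hm : forall x, Y x -> m <= h x) (Yxs : forall k, Y (xs k))
  (hxs : forall k, h (xs k) <= gamma)
  (phi_ge : forall n k, (n <= k)%N -> 1 <= phi n (xs k))
  (phi_le : forall k, exists N, forall n, (N <= n)%N -> phi n (xs k) <= 1 / 4)
  (B0 : 0 < B) (Bg : gamma - m <= B / 4) (radE : rad = 4 * B + 1).

(* The tails of [\sum beta] are negligible with respect to [beta n]; [alpha]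
   leaves room for the loss of slope in [steep_step]. *)
Let beta n : R := B / (n.+1)`!%:R.
Let b n : R := \sum_(i < n) beta i.
Let alpha n : R := 1 / 4 + (4 * n.+1%:R)^-1.

Let beta0 : beta 0 = B.
Proof. exact: divr1. Qed.

Let beta_gt0 n : 0 < beta n.
Proof. by rewrite divr_gt0// ltr0n fact_gt0. Qed.

Let betaS n : beta n.+1 * n.+2%:R = beta n.
Proof.
have f0 : (n.+1)`!%:R != 0 :> R by rewrite pnatr_eq0 -lt0n fact_gt0.
rewrite /beta factS natrM; set c := _%:R in f0 *; set d := _%:R.
by field; rewrite f0 gt_eqF// ltr_wpDr.
Qed.

Let betaS_half n : 2 * beta n.+1 <= beta n.
Proof.
rewrite -[leRHS]betaS mulrC ler_pM2l//.
by rewrite (ler_nat R 2 n.+2).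
Qed.

Let beta_le n : beta n <= B.
Proof.
rewrite ler_pdivrMr ?ltr0n ?fact_gt0// ler_peMr ?(ltW B0)//.
by rewrite ler1n fact_gt0.
Qed.

Let bS n : b n.+1 = b n + beta n.
Proof. by rewrite /b big_ord_recr. Qed.

Let b_ge0 n : 0 <= b n.
Proof. by apply: sumr_ge0 => i _; exact: ltW. Qed.

Let b_tail n j : b (n + j) + 2 * beta (n + j) <= b n + 2 * beta n.
Proof.
elim: j => [|j IH]; first by rewrite addn0.
by rewrite addnS bS; have := betaS_half (n + j); lra.
Qed.

Let b_le n : b n + 2 * beta n <= 2 * B.
Proof.
by have := b_tail 0 n; rewrite add0n /b big_ord0 beta0 add0r.
Qed.

Let alpha_decr n : alpha n.+1 < alpha n.
Proof.
by rewrite ltrD2l ltf_pV2 ?posrE ?mulr_gt0 ?ltr0n// ltr_pM2l// ltr_nat.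
Qed.

Let alpha_ge n : 1 / 4 <= alpha n.
Proof. by rewrite lerDl invr_ge0 mulr_ge0. Qed.

Let alpha_le n : alpha n <= 1 / 2.
Proof.
have -> : 1 / 2 = 1 / 4 + (4 * 1)^-1 :> R by lra.
rewrite lerD2l lef_pV2 ?posrE ?mulr_gt0 ?ltr0n// ler_pM2l//.
by rewrite ler1n.
Qed.

Lemma no_attainment : False.
Proof.
(* The forms [F n - b n * g0], where [g0] is a Banach limit of the chosen forms
   [g n], converge to a form [G] whose maximizer [u'] satisfies
   [g n u' >= g0 u' + 1 / 8] for all large [n], which is absurd. *)
pose T := (set nat * (V -> R) * R)%type.
pose P n (s : T) := let: (E, F, c) := s in
  [/\ unbounded E, linear_form F, forall x, F x <= b n * q x &
    upper_bound E F (b n) c /\ steep E F (b n) c (beta n) (alpha n)].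
pose Q n (s s' : T) := let: (E, F, c) := s in let: (E', F', c') := s' in
  [/\ E' `<=` E, forall k, E' k -> (n <= k)%N,
    exists2 v, hull E v & F' = (fun x => F x + beta n * v x),
    c + beta n * (1 / 4) <= c' &
    exists2 x, Y x & forall k, E' k ->
      c' - 2 * beta n.+1 < F' x - b n.+1 * phi k x - h x].
have [||u [u0 uP uQ]] := @dependent_choice_nat _ P Q (setT, fun=> 0, - m).
- split=> //=.
  + by move=> N; exists N.
  + by split=> *; rewrite ?mulr0 ?addr0.
  + by move=> x; rewrite /b big_ord0 mul0r.
  split=> [x Yx|E' v d _ uE' hv ub].
    by exists 0%N => k _ _; rewrite /b big_ord0; have := hm Yx; lra.
  have [K hK] := hull_eventually_ge phi_ge hv.
  have [N hN] := ub _ (Yxs K); have [N' hN'] := phi_le K.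
  have [k] := uE' (maxn N N'); rewrite geq_max => /andP[Nk N'k] Ek.
  have := hN k Nk Ek; have := hN' k N'k; have := hK K (leqnn _).
  rewrite /b big_ord0 add0r beta0 /= => h1 h2.
  have h3 : B * 1 <= B * v (xs K) by rewrite ler_pM2l.
  have h4 : B * phi k (xs K) <= B * (1 / 4) by rewrite ler_pM2l.
  have h5 : B * alpha 0 <= B * (1 / 2) by rewrite ler_pM2l.
  have h6 := hxs K; rewrite add0r => h7; move: h3 h4 h5 h6 h7 Bg.
  rewrite mulr1.
  by move: (B * v _) (B * phi _ _) (B * alpha _) (h _) => ? ? ? ?; lra.
- move=> n [[E F] c] [uE lF Fb [ubE stE]].
  have rad2 : 2 * (b n + beta n) <= rad.
    by rewrite radE; have := b_le n; have := beta_gt0 n; lra.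
  have [E' [v [c' [[E'E E'n uE' hv] [ub' cc' st' [x Yx hx]]]]]] :=
    steep_step n uE lF Fb (b_ge0 n) (beta_gt0 n) (beta_gt0 n.+1) (alpha_decr n)
      rad2 ubE stE.
  exists (E', fun x => F x + beta n * v x, c'); split; split=> //.
  + by apply: linear_formD => //; apply: linear_formZ; exact: hull_linear hv.
  + move=> y; rewrite bS; have := Fb y; have := hull_le y hv.
    have := beta_gt0 n; nra.
  + by rewrite bS.
  + by exists v.
  + by apply: le_trans cc'; rewrite lerD2l ler_pM2l.
  exists x => // k Ek; rewrite bS; apply: le_lt_trans (hx k Ek).
  have := alpha_decr n; have := alpha_ge n.+1; have := alpha_le n.
  by have := beta_gt0 n.+1; nra.
pose E n := (u n).1.1; pose F n := (u n).1.2; pose c n := (u n).2.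
have uE n : u n = (E n, F n, c n) by rewrite /E /F /c; case: (u n) => [[]].
have hP n : P n (E n, F n, c n) by rewrite -uE.
have hQ n : Q n (E n, F n, c n) (E n.+1, F n.+1, c n.+1) by rewrite -!uE.
have lF n : linear_form (F n) by have [] := hP n.
have /choice[g hg] n : exists v,
    hull (E n) v /\ F n.+1 = (fun x => F n x + beta n * v x).
  by have [_ _ [v hv ->] _ _] := hQ n; exists v.
have /choice[xx hxx] n : exists x, Y x /\ forall k, E n.+1 k ->
      c n.+1 - 2 * beta n.+1 < F n.+1 x - b n.+1 * phi k x - h x.
  by have [_ _ _ _ [x Yx hx]] := hQ n; exists x.
have Emono i j : (i <= j)%N -> E j `<=` E i.
  elim: j => [|j IH]; first by rewrite leqn0 => /eqP ->.
  rewrite leq_eqVlt => /predU1P[->//|/IH]; apply: subset_trans.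
  by have [] := hQ j.
have lg n : linear_form (g n) by exact: hull_linear (hg n).1.
have gq n x : g n x <= q x by exact: hull_le (hg n).1.
have [|g0 lg0 limg] := generalized_limit lg.
  by move=> x; exists (q x).
have g0q x : g0 x <= q x by apply: limg; exists 0%N.
pose D n x := F n x - b n * g0 x.
have lD n : linear_form (D n).
  have -> : D n = fun x => F n x + (- b n) * g0 x.
    by apply/funext => x; rewrite mulNr.
  by apply: linear_formD => //; exact: linear_formZ.
have DS n x : D n.+1 x = D n x + beta n * (g n x - g0 x).
  by rewrite /D bS (hg n).2; ring.
have gg0 n x : `|g n x - g0 x| <= 2 * q x.
  have -> : g n x - g0 x = g n x + (- 1) * g0 x by ring.
  apply: (seminorm_bound qN (f := fun x => g n x + (- 1) * g0 x)) => [|y].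
    by apply: linear_formD => //; exact: linear_formZ.
  have := gq n y; have := g0q (- y); rewrite qN linear_formN//; lra.
have Dtail n j x : `|D (n + j)%N x - D n x| <= 2 * (b (n + j) - b n) * q x.
  elim: j => [|j IH]; first by rewrite addn0 !subrr normr0 mulr0 mul0r.
  rewrite addnS DS addrAC; apply: le_trans (ler_normD _ _) _.
  rewrite normrM gtr0_norm// bS; have := gg0 (n + j)%N x.
  by have := beta_gt0 (n + j); nra.
have Dtail' n j x : `|D (n + j)%N x - D n x| <= 4 * beta n * q x.
  apply: le_trans (Dtail _ _ _) _; apply: ler_wpM2r => //.
  by have := b_tail n j; have := beta_gt0 (n + j); lra.
have D00 x : D 0%N x = 0.
  by rewrite /D /b big_ord0 mul0r subr0 /F u0.
have Dbd n x : D n x <= 4 * B * q x.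
  apply: le_trans (ler_norm _) _.
  by have := Dtail' 0%N n x; rewrite add0n D00 subr0 beta0.
have [|G lG limG] := generalized_limit lD.
  by move=> x; exists (4 * B * q x) => n.
have GD n x : `|G x - D n x| <= 4 * beta n * q x.
  rewrite ler_norml; apply/andP; split.
    rewrite lerBrDr -[G x]mul1r; apply: (generalized_limit_geM lD lG limG).
    exists n => j nj; have := Dtail' n (j - n)%N x.
    by rewrite subnKC// ler_norml => /andP[+ _]; lra.
  rewrite lerBlDr; apply: limG.
  exists n => j nj; have := Dtail' n (j - n)%N x.
  by rewrite subnKC// ler_norml => /andP[_]; lra.
have GB x : G x <= 4 * B * q x by apply: limG; exists 0%N => n _.
have [|u' Yu hu] := attains lG.
  by move=> x; have := GB x; have := q0 x; rewrite radE; lra.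
have [t [M [t0 hcoer]]] : exists t M, 0 < t /\
    forall x, Y x -> t * q x - M <= h x - G x.
  apply: coercive_of_bounded_conjugate => // f lf fq.
  have [||w Yw hw] := @attains (fun x => G x + f x).
  - exact: linear_formD.
  - by move=> x; have := GB x; have := fq x; rewrite radE; lra.
  by exists (G w + f w - h w) => x /hw; lra.
have Dub n x : Y x -> D n x - h x <= c n.
  move=> Yx; have [_ _ _ [ub _]] := hP n; have [N hN] := ub x Yx.
  suff : F n x - h x - c n <= b n * g0 x by rewrite /D; lra.
  apply: (generalized_limit_geM lg lg0 limg); exists (maxn n N.+1) => j.
  rewrite geq_max => /andP[nj Nj].
  rewrite -lerN2 -mulNr; apply: hull_leM (hg j).1 => k Ek.
  have Nk : (N <= k)%N.
    case: j Nj {nj} Ek => // j Nj; have [_ Ej _ _ _] := hQ j => /Ej.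
    exact: leq_trans.
  by have := hN k Nk (Emono _ _ nj _ Ek); lra.
have Dlb n : c n.+1 - 2 * beta n.+1 <= D n.+1 (xx n) - h (xx n).
  suff : b n.+1 * g0 (xx n) <= F n.+1 (xx n) - h (xx n) - c n.+1 + 2 * beta n.+1.
    by rewrite /D; lra.
  apply: (generalized_limit_leM lg lg0 limg); exists n.+1 => j nj.
  apply: hull_leM (hg j).1 => k Ek.
  by have := (hxx n).2 k (Emono _ _ nj _ Ek); lra.
have cS n : c n + beta n * (1 / 4) <= c n.+1 by have [] := hQ n.
have c_ge n : - m <= c n.
  elim: n => [|n IH]; first by rewrite /c u0.
  by have := cS n; have := beta_gt0 n; lra.
pose L := (M + m + 2 * B) * 2 / t.
have hL n : 8 * beta n.+1 <= t -> q (xx n) <= L.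
  move=> bt; rewrite /L ler_pdivlMr//.
  have := hcoer _ (hxx n).1; have := Dlb n; have := c_ge n.+1.
  have := GD n.+1 (xx n); rewrite ler_norml => /andP[+ _].
  have := beta_le n.+1; have := q0 (xx n); nra.
have key n : 8 * beta n.+1 <= t ->
    1 / 4 <= g n u' - g0 u' + (2 + 4 * L + 4 * q u') / n.+2%:R.
  move=> /hL qL; rewrite -(ler_pM2l (beta_gt0 n)).
  have -> : beta n * (g n u' - g0 u' + (2 + 4 * L + 4 * q u') / n.+2%:R) =
    beta n * (g n u' - g0 u') + beta n.+1 * (2 + 4 * L + 4 * q u').
    rewrite mulrDr; congr (_ + _); rewrite -betaS.
    by field; rewrite gt_eqF// ltr_wpDr.
  have := hu _ (hxx n).1; have := Dlb n; have := Dub n _ Yu; have := cS n.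
  have := GD n.+1 (xx n); rewrite ler_norml => /andP[+ _].
  have := GD n.+1 u'; rewrite ler_norml => /andP[_]; rewrite DS.
  have := beta_gt0 n.+1.
  have : beta n.+1 * q (xx n) <= beta n.+1 * L by rewrite ler_pM2l.
  nra.
pose W := 2 + 4 * L + 4 * q u'.
pose N := (Num.truncn (8 * `|W| + 8 * B / t)).+1.
have NW : 8 * `|W| + 8 * B / t < N%:R by exact: truncnS_gt.
have Bt : 0 <= 8 * B / t by rewrite divr_ge0 ?mulr_ge0 ?ltW.
have : g0 u' + 1 / 8 <= 1 * g0 u'.
  apply: (generalized_limit_geM lg lg0 limg); exists N => n Nn.
  have n2 : N%:R <= n.+2%:R :> R.
    by rewrite ler_nat (leq_trans Nn)// -addn2 leq_addr.
  have n20 : 0 < n.+2%:R :> R by [].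
  have bt : 8 * beta n.+1 <= t.
    rewrite -(ler_pM2r n20) -mulrA betaS.
    have : 8 * B / t * t = 8 * B by rewrite divfK// gt_eqF.
    by have := beta_le n; have := normr_ge0 W; nra.
  have k1 := key n bt; rewrite -/W in k1.
  have k2 : W / n.+2%:R <= 1 / 8.
    by rewrite ler_pdivrMr//; have := ler_norm W; lra.
  by move: k1 k2; move: (W / _) => z; lra.
lra.
Qed.

End james.

(** * Gauges and the dual of a locally convex space *)

Section gauge.
Context {R : realType} {V : lmodType R}.
Implicit Types W : set V.

Definition gauge W (x : V) : R := inf [set t | 0 < t /\ W (t^-1 *: x)].

Definition balanced W := forall a x, `|a| <= 1 -> W x -> W (a *: x).

Definition absorbing W := forall x, exists2 t, 0 < t & W (t^-1 *: x).

Variable W : set V.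
Hypotheses (cW : convex_subset W) (bW : balanced W) (aW : absorbing W).

Let S x := [set t | 0 < t /\ W (t^-1 *: x)].

Let S_inf x : has_inf (S x).
Proof.
by split; [have [t] := aW x; exists t|exists 0 => t [/ltW]].
Qed.

Lemma gauge_le t x : 0 < t -> W (t^-1 *: x) -> gauge W x <= t.
Proof. by move=> t0 Wt; apply: ge_inf; [exact: (S_inf x).2|]. Qed.

Lemma gauge_le1 x : W x -> gauge W x <= 1.
Proof. by move=> Wx; apply: gauge_le => //; rewrite invr1 scale1r. Qed.

Lemma gauge_lt t x : gauge W x < t -> W (t^-1 *: x).
Proof.
move=> gt; have e0 : 0 < t - gauge W x by rewrite subr_gt0.
have [s [s0 Ws]] := inf_adherent e0 (S_inf x).
rewrite addrC subrK => st; have t0 : 0 < t by exact: lt_trans st.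
have -> : t^-1 *: x = (s / t) *: (s^-1 *: x).
  by rewrite scalerA mulrAC divff ?gt_eqF// mul1r.
apply: bW => //; rewrite ger0_norm ?divr_ge0 ?ltW//.
by rewrite ltr_pdivrMr// mul1r.
Qed.

Lemma gauge_ge1 x : ~ W x -> 1 <= gauge W x.
Proof.
move=> nW; rewrite leNgt; apply/negP => /gauge_lt.
by rewrite invr1 scale1r.
Qed.

Lemma gaugeN x : gauge W (- x) = gauge W x.
Proof.
have WN y : W y -> W (- y).
  by move=> Wy; rewrite -scaleN1r; apply: bW => //; rewrite normrN1.
congr inf; apply/seteqP; split=> t [t0 /WN]; rewrite ?scalerN ?opprK; split=> //.
by rewrite scalerN.
Qed.

Lemma gauge_ge0 x : 0 <= gauge W x.
Proof. by apply: lb_le_inf; [exact: (S_inf x).1|move=> t [/ltW]]. Qed.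

Lemma gauge_sublinear : sublinear (gauge W).
Proof.
have gD x y : gauge W (x + y) <= gauge W x + gauge W y.
  apply/ler_addgt0Pl => e e0.
  pose s := gauge W x + e / 2; pose t := gauge W y + e / 2.
  have s0 : 0 < s by have := gauge_ge0 x; rewrite /s; lra.
  have t0 : 0 < t by have := gauge_ge0 y; rewrite /t; lra.
  have -> : e + (gauge W x + gauge W y) = s + t by rewrite /s /t; lra.
  apply: gauge_le; first by lra.
  have st0 : s + t != 0 by rewrite gt_eqF//; lra.
  have -> : (s + t)^-1 *: (x + y) = (s / (s + t)) *: (s^-1 *: x) +
      (1 - s / (s + t)) *: (t^-1 *: y).
    have -> : 1 - s / (s + t) = t / (s + t) by field.
    rewrite scalerDr !scalerA; congr (_ *: _ + _ *: _); field.
      by rewrite st0 gt_eqF.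
    by rewrite st0 gt_eqF.
  apply: cW.
  - by apply: gauge_lt; rewrite /s; lra.
  - by apply: gauge_lt; rewrite /t; lra.
  - rewrite divr_ge0 ?ler_pdivrMr ?mul1r; lra.
have gZ a x : 0 < a -> gauge W (a *: x) <= a * gauge W x.
  move=> a0; rewrite mulrC -ler_pdivrMr//.
  apply: lb_le_inf; first exact: (S_inf x).1.
  move=> t [t0 Wt]; rewrite ler_pdivrMr//; apply: gauge_le; first exact: mulr_gt0.
  by rewrite scalerA invfM -mulrA mulVf ?gt_eqF// mulr1.
split=> // a x; rewrite le_eqVlt => /predU1P[<-|a0].
  rewrite scale0r mul0r; apply/eqP; rewrite eq_le gauge_ge0 andbT.
  apply/ler_addgt0Pl => e e0; rewrite addr0; apply: gauge_le => //.
  have [t t0 Wt] := aW 0; rewrite scaler0.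
  by move: Wt; rewrite scaler0.
apply/eqP; rewrite eq_le gZ//=.
have := gZ a^-1 (a *: x); rewrite invr_gt0 => /(_ a0).
by rewrite scalerA mulVf ?gt_eqF// scale1r ler_pdivlMl.
Qed.

Lemma form_le_gauge g x : linear_form g -> (forall y, W y -> g y <= 1) ->
  g x <= gauge W x.
Proof.
move=> lg gW; apply/ler_addgt0Pr => e e0.
have t0 : 0 < gauge W x + e by have := gauge_ge0 x; lra.
have /gW : W ((gauge W x + e)^-1 *: x) by apply: gauge_lt; rewrite ltrDl.
by rewrite lg.2 ler_pdivrMl// mulr1.
Qed.

End gauge.

Lemma convex_setP (R : realType) (V : lmodType R) (A : set V) :
  convex_set A <-> convex_subset A.
Proof.
split=> [cA x y s Ax Ay /andP[s0 s1]|cA x y l /set_mem Ax /set_mem Ay].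
  by have := cA x y (Itv01 s0 s1) (mem_set Ax) (mem_set Ay); rewrite inE.
by apply/mem_set; apply: cA => //; rewrite ge0 le1.
Qed.

Section tvs.
Context {R : realType} {X : tvsType R}.
Implicit Types (V W C : set X) (f : dual X).

Lemma dual_linear_form f : linear_form f.
Proof. by split; [exact: dualD|exact: dualZ]. Qed.

Lemma dualE_add f g x : (f + g) x = f x + g x. Proof. by []. Qed.

Lemma dualE_scale a f x : (a *: f) x = a * f x. Proof. by []. Qed.

Lemma dualE_opp f x : (- f) x = - f x. Proof. by []. Qed.

Lemma nbhs0_absorbing V : nbhs 0 V -> absorbing V.
Proof.
move=> V0 x; have := @scale_continuous R X (0, x) V.
rewrite /= scale0r => /(_ V0)[[A B] [/= A0 Bx] AB].
move: A0; rewrite -nbhs_ballE => -[e /= e0 eA].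
exists (e / 2)^-1; first by rewrite invr_gt0 divr_gt0.
rewrite invrK; apply: (AB (e / 2, x)); split=> /=; last exact: nbhs_singleton.
apply: eA; rewrite /ball/= sub0r normrN ger0_norm; lra.
Qed.

Lemma nbhs0_convex_balanced V : nbhs 0 V ->
  exists W, [/\ nbhs 0 W, convex_subset W, balanced W & W `<=` V].
Proof.
move=> V0; have [B Bc [Bo Bb]] := @locally_convex R X.
have [U [BU U0] UV] := Bb 0 V V0.
have cU : convex_subset U by apply/convex_setP; apply: Bc; exact/mem_set.
have nU : nbhs 0 U by apply: open_nbhs_nbhs; split=> //; exact: Bo.
pose W := U `&` [set x | U (- x)].
have cW : convex_subset W.
  move=> x y s [Ux Ux'] [Uy Uy'] s01; split; first exact: cU.
  by rewrite /= opprD -!scalerN; exact: cU.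
have W0 : W 0 by split=> //=; rewrite oppr0.
have WN x : W x -> W (- x) by move=> [Ux Ux']; split=> //=; rewrite opprK.
exists W; split=> //; last by move=> x [/UV].
  apply: filterI => //.
  have := nbhs0N nU; apply: filterS => _ [y Uy <-]; by rewrite /= opprK.
have WZ a x : 0 <= a <= 1 -> W x -> W (a *: x).
  by move=> a01 Wx; have := cW _ _ a Wx W0 a01; rewrite scaler0 addr0.
move=> a x a1 Wx; have [a0|a0] := leP 0 a.
  by apply: WZ => //; rewrite a0/=; rewrite ger0_norm in a1.
rewrite -[a]opprK scaleNr -scalerN; apply: WZ; last exact: WN.
by rewrite ltr0_norm// in a1; rewrite a1 andbT oppr_ge0 ltW.
Qed.

Lemma dual_of_linear_form (g : X -> R) V : linear_form g -> nbhs 0 V ->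
  (forall x, V x -> g x <= 1) -> exists f, forall x, f x = g x.
Proof.
move=> lg V0 gV; have [W [W0 _ bW WV]] := nbhs0_convex_balanced V0.
suff cg : (g : X -> R^o) \in @continuous_linear R X by exists (Dual cg).
apply/asboolP; split.
  by move=> a x y; rewrite lg.1 lg.2.
move=> x; apply/cvgrPdist_le => e e0.
have := nbhs0Z (lt0r_neq0 e0) W0 => /(nbhsT x).
apply: filterS => _ [_ [y Wy <-] <-].
rewrite lg.1 lg.2 opprD addrA subrr sub0r normrN normrM gtr0_norm//.
rewrite -[leRHS]mulr1 ler_pM2l// ler_norml; apply/andP; split; last exact/gV/WV.
rewrite lerNl -linear_formN//; apply/gV/WV; rewrite -scaleN1r.
by apply: bW => //; rewrite normrN1.
Qed.

Lemma weak_cvg (F : set_system X) (x : X) : Filter F ->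
  (forall f e, 0 < e -> F [set y | `|f y - f x| < e]) -> F --> (x : weak X).
Proof.
move=> FF h; apply/cvg_sup => f A /=.
rewrite (@nbhsE (initial_topology (f : X -> R^o))) => -[B [[C oC <-] /= Cx] BA].
have : nbhs (f x) C by apply: open_nbhs_nbhs.
rewrite -nbhs_ballE => -[e /= e0 eC].
apply: filterS (h f e e0) => y /= fy; apply: BA; apply: eC.
by rewrite /ball/= distrC.
Qed.

Lemma weak_nbhs (f : dual X) (x : X) e : 0 < e ->
  nbhs (x : weak X) [set y | `|f y - f x| < e].
Proof.
move=> e0; have /cvgrPdist_lt/(_ e e0) := @weak_continuous_dual R X f x.
by apply: filterS => y /=; rewrite distrC.
Qed.

Lemma weak_closed_halfspace (f : dual X) c :
  closed ([set x | f x <= c] : set (weak X)).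
Proof.
apply: (@closed_comp (weak X) R^o (f : weak X -> R^o) [set t | t <= c]).
  by move=> x _; exact: weak_continuous_dual.
exact: closed_le.
Qed.

(* Grothendieck's completeness theorem. *)
Lemma evaluation_of_uniform_approximation (xi : dual X -> R) :
  tvs_complete X -> (forall a f, xi (a *: f) = a * xi f) ->
  (forall V, nbhs 0 V -> exists x, forall f, (forall v, V v -> f v <= 1) ->
     `|f x - xi f| <= 1) ->
  exists x, forall f, f x = xi f.
Proof.
move=> cX xiZ happ.
pose S V := [set x | forall f, (forall v, V v -> f v <= 1) -> `|f x - xi f| <= 1].
pose F : set_system X := filter_from [set V | nbhs 0 V] S.
have FF : ProperFilter F.
  apply: filter_from_proper; last by move=> V /happ.
  apply: filter_from_filter; first by exists setT; exact: filterT.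
  move=> V W /= V0 W0; exists (V `&` W); first exact: filterI.
  by move=> x Sx; split=> f hf; apply: Sx => v [Vv Wv]; exact: hf.
have [W W0|x Fx] := cX F FF.
  have [V [V0 cV bV VW]] := nbhs0_convex_balanced W0.
  pose V3 := [set 3^-1 *: v | v in V].
  have V30 : nbhs 0 V3 by apply: nbhs0Z.
  exists (S V3); first by exists V3.
  move=> x y Sx Sy; apply: VW.
  have aV := nbhs0_absorbing V0.
  have sV := gauge_sublinear cV bV aV.
  have [g [lg gV gxy]] := sublinear_norming (x - y) sV.
  have g1 v : V v -> g v <= 1.
    by move=> Vv; apply: le_trans (gV v) (gauge_le1 aV Vv).
  have [f fE] := dual_of_linear_form lg V0 g1.
  have f3 v : V3 v -> (3 *: f) v <= 1.
    by move=> [w Vw <-]; rewrite dualE_scale fE lg.2 mulrA mulfV// mul1r g1.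
  have := Sx _ f3; have := Sy _ f3; rewrite !dualE_scale !fE xiZ !ler_norml.
  move=> /andP[h1 h2] /andP[h3 h4].
  have : gauge V (x - y) < 1 by rewrite -gxy linear_formB//; lra.
  by move=> /(gauge_lt bV aV); rewrite invr1 scale1r.
exists x => f; apply/eqP; rewrite -subr_eq0 -normr_le0.
apply/ler_addgt0Pl => e e0; rewrite addr0.
pose V := [set v | `|f v| < e / 2].
have e2 : 0 < e / 2 by rewrite divr_gt0.
have fcont z : nbhs z [set v | `|f z - f v| < e / 2].
  by have /cvgrPdist_lt/(_ _ e2) := @dual_continuous R X f z.
have V0 : nbhs 0 V.
  have := fcont 0; apply: filterS => v /=.
  by rewrite dual0 sub0r normrN.
have FV : F [set y | `|f y - xi f| <= e / 2].
  exists V => // y Sy /=.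
  have /Sy : forall v, V v -> ((e / 2)^-1 *: f) v <= 1.
    move=> v Vv; rewrite dualE_scale ler_pdivrMl// mulr1.
    by apply: le_trans (ler_norm _) (ltW Vv).
  rewrite dualE_scale xiZ -mulrBr normrM gtr0_norm ?invr_gt0//.
  by rewrite ler_pdivrMl// mulr1.
have [y [/= fy hy]] := filter_ex (filterI FV (Fx _ (fcont x))).
have -> : f x - xi f = (f x - f y) + (f y - xi f) by ring.
by apply: le_trans (ler_normD _ _) _; lra.
Qed.

End tvs.

(** * Weak compactness of sublevel sets *)

Section weak_compactness.
Context {R : realType} {X : tvsType R}.
Implicit Types (V W C K A : set X) (f : dual X).

Lemma weakly_compact_bounded C f : weakly_compact C ->
  exists2 M, 0 < M & forall x, C x -> `|f x| <= M.
Proof.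
move=> cC.
have : compact ((f : weak X -> R^o) @` (C : set (weak X))).
  apply: continuous_compact => //; apply: continuous_subspaceT.
  exact: weak_continuous_dual.
move=> /compact_bounded[M [_ hM]]; exists (`|M| + 1); first by rewrite ltr_pwDr.
move=> x Cx; apply: (hM (`|M| + 1)); last by exists x.
by apply: le_lt_trans (ler_norm _) _; rewrite ltrDl.
Qed.

Lemma mackey_gauge_segment (x : X) :
  mackey_gauge [set a *: x | a in [set a : R | `|a| <= 1]].
Proof.
split.
- have -> : [set a *: x | a in [set a : R | `|a| <= 1]] =
      (fun a : R^o => a *: x : weak X) @` `[-1, 1]%classic.
    apply/seteqP; split=> _ [a /= a1 <-]; exists a => //=; move: a1.
      by rewrite ler_norml in_itv.
    by rewrite in_itv/= ler_norml.
  apply: (@continuous_compact R^o (weak X)); last exact: segment_compact.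
  apply: continuous_subspaceT; apply: continuous_weak => f.
  have -> : (fun a : R^o => f (a *: x) : R^o) = (fun a : R^o => a * f x).
    by apply/funext => a; rewrite dualZ.
  by move=> a; apply: cvgMr_tmp; exact: cvg_id.
- move=> b _ b1 [a /= a1 <-]; exists (b * a); last by rewrite scalerA.
  by rewrite /= normrM -[leRHS]mul1r ler_pM.
- apply/convex_setP => _ _ s [a /= a1 <-] [b /= b1 <-] /andP[s0 s1].
  exists (s * a + (1 - s) * b); last by rewrite [LHS]scalerDl -!scalerA.
  move: a1 b1; rewrite /= !ler_norml => /andP[? ?] /andP[? ?].
  by apply/andP; split; nra.
Qed.

Lemma ultrafilter_limit (F : set_system X) A f M : UltraFilter F -> F A ->
  (forall x, A x -> `|f x| <= M) ->
  exists l, forall e, 0 < e -> F [set x | `|f x - l| < e].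
Proof.
move=> FU FA AM.
have FF : ProperFilter F by exact: ultra_proper.
have : compact (`[- M, M]%classic : set R^o) by exact: segment_compact.
move=> /(_ _ (fmap_proper_filter (f : X -> R^o) FF)) [|l [_ cl]].
  suff : F (f @^-1` (`[- M, M]%classic : set R^o)) by [].
  by apply: filterS FA => x /AM; rewrite ler_norml /= in_itv.
exists l => e e0; have [//|nF] := in_ultra_setVsetC [set x | `|f x - l| < e] FU.
have := cl (~` [set t | `|t - l| < e]) [set t | `|t - l| < e] nF.
have : nbhs (l : R^o) [set t | `|t - l| < e].
  by apply/nbhs_normP; exists e => // t; rewrite /ball_/= distrC.
by move=> /[swap] /[apply] -[t []].
Qed.

Definition vsum C W := [set x + y | x in C & y in W].

Lemma vsum_mackey_gauge C V : mackey_gauge C -> C 0 -> nbhs 0 V ->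
  convex_subset V -> balanced V ->
  [/\ convex_subset (vsum C V), balanced (vsum C V) & absorbing (vsum C V)].
Proof.
move=> [_ bC vC] C0 V0 cV bV; split.
- move=> _ _ s [x Cx [y Vy <-]] [x' Cx' [y' Vy' <-]] s01.
  exists (s *: x + (1 - s) *: x'); first by move/convex_setP: vC; exact.
  exists (s *: y + (1 - s) *: y'); first exact: cV.
  by rewrite !scalerDr addrACA.
- move=> a _ a1 [x Cx [y Vy <-]]; exists (a *: x); first exact: bC.
  by exists (a *: y); [exact: bV|rewrite scalerDr].
- move=> x; have [t t0 Vt] := nbhs0_absorbing V0 x.
  by exists t => //; exists 0 => //; exists (t^-1 *: x) => //; rewrite add0r.
Qed.

Section separation.
Variables (F : set_system X) (xi : dual X -> R) (V : set X).
Hypotheses (FF : ProperFilter F)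
  (Fxi : forall f e, 0 < e -> F [set x | `|f x - xi f| < e])
  (xiN : forall f, xi (- f) = - xi f)
  (V0 : nbhs 0 V) (cV : convex_subset V) (bV : balanced V)
  (Vxi : forall x, exists f, (forall v, V v -> f v <= 1) /\ 1 < `|f x - xi f|).

(* Otherwise the points of [C] within [V] of the convex sets of [F] would
   cluster in [C] at a point approximating [xi] on the polar of [V]. *)
Lemma convex_set_far C : weakly_compact C ->
  exists B, [/\ F B, convex_subset B & forall x, B x -> ~ vsum C V x].
Proof.
move=> cC; apply: contrapT => nB.
pose D B := [set c | C c /\ exists2 v, V v & B (c + v)].
pose G : set_system (weak X) :=
  filter_from [set B | F B /\ convex_subset B] D.
have GF : ProperFilter G.
  apply: filter_from_proper.
    apply: filter_from_filter; first by exists setT; split=> //; exact: filterT.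
    move=> B B' [FB cB] [FB' cB']; exists (B `&` B').
      split; first exact: filterI.
      by move=> x y s [Bx B'x] [By B'y] s01; split; [exact: cB|exact: cB'].
    by move=> c [Cc [v Vv [Bv B'v]]]; split; split=> //; exists v.
  move=> B [FB cB]; apply: contrapT => nD; apply: nB; exists B; split=> //.
  move=> x Bx [c Cc [v Vv xE]]; apply: nD; exists c; split=> //; exists v => //.
  by rewrite xE.
have GC : G C by exists setT; [split=> //; exact: filterT|move=> c []].
have [x [Cx clx]] := cC G GF GC.
have [f [fV fx]] : exists f, (forall v, V v -> f v <= 1) /\ 1 < xi f - f x.
  have [f [fV]] := Vxi x; rewrite ltr_normr => /orP[fx|]; last first.
    by exists f; split=> //; lra.
  exists (- f); split=> [v Vv|]; last by rewrite dualE_opp xiN; lra.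
  rewrite dualE_opp -linear_formN; last exact: dual_linear_form.
  by apply: fV; rewrite -scaleN1r; apply: bV => //; rewrite normrN1.
pose e := (xi f - f x - 1) / 2.
have e0 : 0 < e by rewrite /e; lra.
pose B := [set y | xi f - e < f y].
have FB : F B.
  apply: filterS (Fxi f e0) => y /=; rewrite ltr_norml => /andP[+ _].
  by rewrite /B/=; lra.
have cB : convex_subset B.
  move=> y z s; rewrite /B/= => By Bz /andP[s0 s1].
  have [fD fZ] := dual_linear_form f; rewrite fD !fZ.
  have [->|sn0] := eqVneq s 0; first lra.
  have {sn0}s0 : 0 < s by rewrite lt_def sn0.
  nra.
have GB : G (D B) by exists B.
have [c [[Cc [v Vv]] /=]] := clx _ _ GB (weak_nbhs f x e0).
rewrite /B/= dualD ltr_norml => h1 /andP[_ h2].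
by have := fV v Vv; rewrite /e in h1 h2; lra.
Qed.

Lemma separating_form C : mackey_gauge C -> C !=set0 ->
  exists g : X -> R, [/\ linear_form g, forall x, vsum C V x -> g x <= 1 &
    F [set x | 1 <= g x]].
Proof.
move=> gC C00.
have C0 : C 0 by apply: circled0 => //; case: gC.
have [B [FB cB BCV]] := convex_set_far (let: And3 cC _ _ := gC in cC).
have [b Bb] := filter_ex FB.
have [cW bW aW] := vsum_mackey_gauge gC C0 V0 cV bV.
have [||x /BCV|g [lg gW gB]] :=
  @sublinear_separation _ _ _ B 1 (gauge_sublinear cW bW aW).
- by exists b.
- exact: cB.
- exact: gauge_ge1.
exists g; split=> // [x Wx|]; last by apply: filterS FB.
exact: le_trans (gW x) (gauge_le1 aW Wx).
Qed.

Lemma james_sequence A C0 : F A -> mackey_gauge C0 -> C0 !=set0 ->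
  exists (phi : nat -> X -> R) (xs : nat -> X),
    [/\ forall n, linear_form (phi n),
        forall n x, vsum C0 V x -> phi n x <= 1,
        forall n, A (xs n),
        forall n k, (n <= k)%N -> 1 <= phi n (xs k) &
        forall n k, (k < n)%N -> phi n (xs k) <= 1 / 4].
Proof.
move=> FA gC0 C00.
pose P (n : nat) (s : set X * set X) := [/\ mackey_gauge s.1, C0 `<=` s.1 & F s.2].
pose Q (n : nat) (s s' : set X * set X) := exists (g : X -> R) x,
  [/\ linear_form g, forall x, vsum s.1 V x -> g x <= 1, A x /\ s'.2 x,
      s'.2 `<=` s.2 `&` [set x | 1 <= g x] & s.1 `<=` s'.1 /\ s'.1 (4 *: x)].
have [||u [u0 uP uQ]] := @dependent_choice_nat _ P Q (C0, setT).
- by split=> //; exact: filterT.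
- move=> n [C E] [/= gC C0C FE].
  have Cn0 : C !=set0 by case: C00 => x /C0C; exists x.
  have [g [lg gCV Fg]] := separating_form gC Cn0.
  pose E' := E `&` [set x | 1 <= g x].
  have FE' : F E' by exact: filterI.
  have [x [Ax E'x]] := filter_ex (filterI FA FE').
  pose I := [set a *: (4 *: x) | a in [set a : R | `|a| <= 1]].
  have I0 : I 0 by exists 0; rewrite ?scale0r//= normr0.
  have CI : C `<=` vsum C I.
    by move=> c Cc; exists c => //; exists 0 => //; rewrite addr0.
  exists (vsum C I, E'); split.
    split=> //=; last exact: subset_trans CI.
    by apply: mackey_gauge_add => //; exact: mackey_gauge_segment.
  exists g, x; split=> //; split=> //=.
  have C0' : C 0 by apply: circled0 => //; case: gC.
  exists 0 => //; exists (4 *: x); last by rewrite add0r.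
  by exists 1; rewrite ?scale1r//= normr1.
have /choice[phi /choice[xs h]] := uQ.
exists phi, xs.
have mono1 i j : (i <= j)%N -> (u i).1 `<=` (u j).1.
  elim: j => [|j IH]; first by rewrite leqn0 => /eqP ->.
  rewrite leq_eqVlt => /predU1P[->//|/IH ij]; apply: subset_trans ij _.
  by have [_ _ _ _ []] := h j.
have mono2 i j : (i <= j)%N -> (u j).2 `<=` (u i).2.
  elim: j => [|j IH]; first by rewrite leqn0 => /eqP ->.
  rewrite leq_eqVlt => /predU1P[->//|/IH ij]; apply: subset_trans ij.
  by have [_ _ _ hj _] := h j => x /hj[].
split.
- by move=> n; have [] := h n.
- move=> n x [c Cc [v Vv <-]]; have [_ hn _ _ _] := h n; apply: hn.
  by exists c; [have [_ + _] := uP n; exact|exists v].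
- by move=> n; have [_ _ [] ] := h n.
- move=> n k nk; have [_ _ _ hn _] := h n; have [_ _ [_ hk] _ _] := h k.
  by have [] := hn _ (mono2 n.+1 k.+1 nk _ hk).
- move=> n k kn; have [[_ gZ] hn _ _ _] := h n; have [_ _ _ _ [_ hk]] := h k.
  have : phi n (4 *: xs k) <= 1.
    apply: hn; exists (4 *: xs k); first exact: mono1 hk.
    by exists 0; [exact: nbhs_singleton|rewrite addr0].
  by rewrite gZ; lra.
Qed.

End separation.

Lemma weakly_compact_of_attainment (Y : set X) (h : X -> R) K gamma :
  tvs_complete X -> mackey_gauge K ->
  (forall f, polar K f ->
     exists2 u, Y u & forall x, Y x -> f x - h x <= f u - h u) ->
  closed ([set x | Y x /\ h x <= gamma] : set (weak X)) ->
  weakly_compact [set x | Y x /\ h x <= gamma].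
Proof.
move=> cX gK0 hmin0; set A := [set x | _] => clA.
have [K1 [gK K0 K1K]] : exists K1, [/\ mackey_gauge K1, K1 0 &
    forall f, (forall x, K1 x -> f x <= 1) -> polar K f].
  have [[x Kx]|K0] := pselect (K !=set0).
    exists K; split=> //; last by move=> f /polarP.
    by apply: circled0; [case: gK0|exists x].
  exists [set 0]; split=> //; first exact: mackey_gauge_set1.
  by move=> f _; apply/polarP => x Kx; case: K0; exists x.
have hmin f : (forall x, K1 x -> f x <= 1) ->
  exists2 u, Y u & forall x, Y x -> f x - h x <= f u - h u.
  by move=> /K1K/hmin0.
have [u0 Yu0 hu0] : exists2 u, Y u & forall x, Y x -> h u <= h x.
  have [|u Yu hu] := hmin 0; first by move=> x _; exact: ler01.
  exists u => // x /hu.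
  have -> : (0 : dual X) x = 0 by [].
  have -> : (0 : dual X) u = 0 by [].
  lra.
have bnd1 f : exists M, forall x, A x -> f x <= M.
  have [M M0 hM] := weakly_compact_bounded f (let: And3 cK _ _ := gK in cK).
  have [|u Yu hu] := hmin (M^-1 *: f).
    move=> x K1x; rewrite dualE_scale ler_pdivrMl// mulr1.
    exact: le_trans (ler_norm _) (hM x K1x).
  exists (M * ((M^-1 *: f) u - h u + gamma)) => x [/hu + hx].
  by rewrite -ler_pdivrMl// dualE_scale; lra.
have bnd f : exists M, forall x, A x -> `|f x| <= M.
  have [M hM] := bnd1 f; have [M' hM'] := bnd1 (- f).
  exists (Num.max M M') => x Ax; rewrite ler_norml le_max hM// andbT.
  by rewrite lerNl le_max; have := hM' x Ax; rewrite dualE_opp => ->; rewrite orbT.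
rewrite /weakly_compact compact_ultra => F FU FA.
have FF : ProperFilter F by exact: ultra_proper.
have /choice[xi Fxi] f : exists l, forall e, 0 < e -> F [set x | `|f x - l| < e].
  by have [M hM] := bnd f; exact: ultrafilter_limit FA hM.
have xiZ a f : xi (a *: f) = a * xi f.
  apply/eqP; rewrite -subr_eq0 -normr_le0.
  apply/ler_addgt0Pl => e e0; rewrite addr0.
  have a1 : 0 < 1 + `|a| by rewrite ltr_pwDl.
  have e'0 : 0 < e / (1 + `|a|) by rewrite divr_gt0.
  have [x [/= h1 h2]] := filter_ex (filterI (Fxi f _ e'0) (Fxi (a *: f) _ e'0)).
  have -> : xi (a *: f) - a * xi f =
      a * (f x - xi f) - ((a *: f) x - xi (a *: f)).
    by rewrite dualE_scale; ring.
  apply: le_trans (ler_normB _ _) _; rewrite normrM.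
  have := normr_ge0 a; have : e / (1 + `|a|) * (1 + `|a|) = e.
    by rewrite divfK// gt_eqF.
  nra.
have [[x hx]|nE] := pselect (exists x, forall f, f x = xi f).
  have Fx : F --> (x : weak X).
    by apply: weak_cvg => f e e0; rewrite hx; exact: Fxi.
  exists x; split=> //; apply: clA => B /Fx FB.
  exact: filter_ex (filterI FA FB).
exfalso.
have [V [V0 cV bV Vxi]] : exists V, [/\ nbhs 0 V, convex_subset V, balanced V &
    forall x, exists f, (forall v, V v -> f v <= 1) /\ 1 < `|f x - xi f|].
  apply: contrapT => nV; apply: nE.
  apply: evaluation_of_uniform_approximation => // V V0.
  apply: contrapT => nx; apply: nV.
  have [W [W0 cW bW WV]] := nbhs0_convex_balanced V0.
  exists W; split=> // x; apply: contrapT => nf; apply: nx; exists x => f fV.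
  rewrite leNgt; apply/negP => fx; apply: nf; exists f; split=> // v /WV.
  exact: fV.
have xiN f : xi (- f) = - xi f by rewrite -scaleN1r xiZ mulN1r.
pose B := 4 * `|gamma - h u0| + 1.
have B0 : 0 < B by rewrite /B ltr_wpDl// mulr_ge0.
pose rad := 4 * B + 1.
have rad0 : 0 < rad by rewrite /rad; lra.
pose C0 := [set rad *: x | x in K1].
have gC0 : mackey_gauge C0 by exact: mackey_gauge_scale.
have C00 : C0 0 by exists 0 => //; rewrite scaler0.
have C0n : C0 !=set0 by exists 0.
have [phi [xs [lphi phi1 Axs phige phile]]] :=
  james_sequence FF Fxi xiN V0 cV bV Vxi FA gC0 C0n.
have [cW bW aW] := vsum_mackey_gauge gC0 C00 V0 cV bV.
have vC x : C0 x -> vsum C0 V x.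
  by move=> Cx; exists x => //; exists 0; [exact: nbhs_singleton|rewrite addr0].
have vV x : V x -> vsum C0 V x.
  by move=> Vx; exists 0 => //; exists x => //; rewrite add0r.
apply: (@no_attainment R X (gauge (vsum C0 V)) Y h phi _ _ lphi _ rad _ xs gamma
  (h u0) B hu0 _ _ phige _ B0).
- exact: gauge_sublinear.
- exact: gaugeN.
- by move=> n x; apply: form_le_gauge => //; exact: phi1.
- move=> G lG Gq.
  have Grad x : vsum C0 V x -> G x <= rad.
    move=> Wx; apply: le_trans (Gq x) _; rewrite ger_pMr//.
    exact: gauge_le1.
  have [||f fE] := @dual_of_linear_form _ _ (fun x => rad^-1 * G x) V _ V0.
  + exact: linear_formZ.
  + by move=> x /vV/Grad; rewrite ler_pdivrMl// mulr1.
  have fG x : (rad *: f) x = G x.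
    by rewrite dualE_scale fE mulrA mulfV ?gt_eqF// mul1r.
  have [|u Yu hu] := hmin (rad *: f).
    move=> x K1x; rewrite fG.
    have /vC/Grad : C0 (rad *: x) by exists x.
    by rewrite lG.2 -ler_pdivlMl// mulVf// gt_eqF.
  by exists u => // x /hu; rewrite !fG.
- by move=> k; have [] := Axs k.
- by move=> k; have [] := Axs k.
- by move=> k; exists k.+1 => n kn; exact: phile.
- rewrite /B; have := ler_norm (gamma - h u0).
  by have := normr_ge0 (gamma - h u0); lra.
- by [].
Qed.

End weak_compactness.

(** * Epigraphs and conjugates *)

Section gauge_difference.
Context {R : realType} {X : tvsType R}.

Lemma mackey_gauge_difference (L : set X) : weakly_compact L ->
  convex_subset L -> mackey_gauge [set x - y | x in L & y in L].
Proof.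
move=> cL vL; split.
- have -> : [set x - y | x in L & y in L] =
      (fun p : weak X * weak X => (p.1 : X) - p.2 : weak X) @`
        ((L : set (weak X)) `*` (L : set (weak X))).
    apply/seteqP; split=> z.
      by move=> [x Lx [y Ly <-]]; exists (x, y).
    by move=> [[x y] [/= Lx Ly] <-]; exists x => //; exists y.
  apply: (@continuous_compact (weak X * weak X)%type (weak X)); last first.
    exact: (@compact_setX (weak X) (weak X) L L cL cL).
  apply: continuous_subspaceT; apply: continuous_weak => phi.
  have -> : (fun p : weak X * weak X => phi ((p.1 : X) - p.2) : R^o) =
      (fun p => phi p.1 - phi p.2).
    by apply/funext => p; rewrite (linear_formB _ _ (dual_linear_form phi)).
  move=> p; apply: cvgB.
    by apply: continuous_comp; [exact: cvg_fst|exact: weak_continuous_dual].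
  by apply: continuous_comp; [exact: cvg_snd|exact: weak_continuous_dual].
- have pos a x y : 0 <= a <= 1 -> L x -> L y ->
      exists2 x', L x' & exists2 y', L y' & x' - y' = a *: (x - y).
    move=> a01 Lx Ly; exists (a *: x + (1 - a) *: y); first exact: vL.
    by exists y => //; rewrite scalerBl scale1r scalerBr addrA addrAC addrK.
  move=> a _ a1 [x Lx [y Ly <-]]; have [a0|a0] := leP 0 a.
    by apply: pos => //; rewrite a0 /=; rewrite ger0_norm in a1.
  rewrite -[a]opprK scaleNr -scalerN opprB; apply: pos => //.
  by rewrite ltr0_norm// in a1; rewrite a1 andbT oppr_ge0 ltW.
- apply/convex_setP => _ _ s [x Lx [y Ly <-]] [x' Lx' [y' Ly' <-]] s01.
  exists (s *: x + (1 - s) *: x'); first exact: vL.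
  exists (s *: y + (1 - s) *: y'); first exact: vL.
  by rewrite !scalerBr opprD addrACA.
Qed.

End gauge_difference.

Section product_duality.
Context {R : realType} {X : tvsType R}.

Lemma dual_fst (phi : dual X) :
  exists psi : dual (X * R^o)%type, forall p, psi p = phi p.1.
Proof.
suff c : (fun p : X * R^o => phi p.1 : R^o) \in @continuous_linear R (X * R^o)%type.
  by exists (Dual c).
apply/asboolP; split.
  by move=> a p p'; rewrite /= dual_linearP.
by move=> p; apply: continuous_comp; [exact: cvg_fst|exact: dual_continuous].
Qed.

Lemma dual_snd : exists psi : dual (X * R^o)%type, forall p, psi p = p.2.
Proof.
suff c : (fun p : X * R^o => p.2) \in @continuous_linear R (X * R^o)%type.
  by exists (Dual c).
apply/asboolP; split; first by move=> a p p'.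
by move=> p; exact: cvg_snd.
Qed.

Lemma dual_pair (psi : dual (X * R^o)%type) : exists phi : dual X,
  forall x t, psi (x, t) = phi x + t * psi (0, 1).
Proof.
have c : (fun x : X => psi (x, 0) : R^o) \in @continuous_linear R X.
  apply/asboolP; split.
    move=> a x y; rewrite -[RHS](dual_linearP psi).
    by congr (psi _); congr pair; rewrite /= scaler0 addr0.
  move=> x; apply: (@continuous_comp _ _ _ (fun x : X => (x, 0 : R^o)) psi).
    apply: (@cvg_pair _ _ _ _ (nbhs x) (nbhs (0 : R^o))); first exact: cvg_id.
    exact: cvg_cst.
  exact: dual_continuous.
exists (Dual c) => x t; rewrite -(dualZ psi) /= -(dualD psi).
congr (psi _); congr pair; rewrite /= ?scaler0 ?addr0// add0r.
by rewrite /GRing.scale/= mulr1.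
Qed.

Lemma weakly_compact_setX_segment (A : set X) (a b : R) : weakly_compact A ->
  weakly_compact [set p : X * R^o | A p.1 /\ a <= p.2 <= b].
Proof.
move=> cA.
have -> : [set p : X * R^o | A p.1 /\ a <= p.2 <= b] =
    (fun p : weak X * R^o => p : weak (X * R^o)%type) @`
      ((A : set (weak X)) `*` (`[a, b]%classic : set R^o)).
  apply/seteqP; split=> [p [Ap ab]|_ [p [Ap ab] <-]].
    by exists p => //; split=> //=; rewrite in_itv.
  by split=> //; move: ab; rewrite /= in_itv.
apply: (@continuous_compact (weak X * R^o)%type); last first.
  by apply: compact_setX => //; exact: segment_compact.
apply: continuous_subspaceT; apply: continuous_weak => psi.
have [phi hphi] := dual_pair psi.
have -> : (fun p : weak X * R^o => psi p : R^o) =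
    (fun p => phi p.1 + p.2 * psi (0, 1)).
  by apply/funext => -[x t]; rewrite hphi.
move=> p; apply: cvgD.
  by apply: continuous_comp; [exact: cvg_fst|exact: weak_continuous_dual].
by apply: cvgMr_tmp; exact: cvg_snd.
Qed.

End product_duality.

Section epigraph.
Context {R : realType} {X : tvsType R}.
Variables (f : X -> \bar R) (U : set (dual X)) (c : dual X -> R).
Hypotheses (X_complete : tvs_complete X) (U_open : open (U : set (mackey X)))
  (f_ge : forall phi x, U phi -> ((phi x + c phi)%:E <= f x)%E)
  (f_eq : forall phi, U phi -> exists u, f u = (phi u + c phi)%:E).

(* [envelope xs s] is a sublevel set of [g - xs], where [g] is the supremum of
   the affine minorants of [f] with slope in [U]. *)
Definition envelope (xs : dual X) (s : R) : set X :=
  [set x | forall phi, U phi -> phi x + c phi - xs x <= s].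

Lemma sublevel_envelope (xs : dual X) s x :
  (f x - (xs x)%:E <= s%:E)%E -> envelope xs s x.
Proof.
move=> fx phi Uphi; rewrite -lee_fin EFinB; apply: le_trans fx.
by apply: leeD2r; exact: f_ge.
Qed.

Lemma envelope_closed xs s : closed (envelope xs s : set (weak X)).
Proof.
have -> : envelope xs s =
    \bigcap_(phi in U) [set x | (phi - xs : dual X) x <= s - c phi].
  apply/seteqP; split=> [x hx phi Uphi|x hx phi Uphi].
    have := hx phi Uphi.
    change (phi x + c phi - xs x <= s -> phi x - xs x <= s - c phi); lra.
  have := hx phi Uphi.
  change (phi x - xs x <= s - c phi -> phi x + c phi - xs x <= s); lra.
by apply: closed_bigI => phi _; exact: weak_closed_halfspace.
Qed.

Lemma envelope_convex xs s x y a b t : envelope xs a x -> envelope xs b y ->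
  0 <= t <= 1 -> t * a + (1 - t) * b <= s -> envelope xs s (t *: x + (1 - t) *: y).
Proof.
move=> hx hy /andP[t0 t1] ab phi Uphi; apply: le_trans ab.
have := hx phi Uphi; have := hy phi Uphi; rewrite !dualD !dualZ.
have [->|tn0] := eqVneq t 0; first lra.
have {tn0}t0' : 0 < t by rewrite lt_def tn0.
nra.
Qed.

Lemma mackey_neighborhood xs : U xs ->
  exists2 K, mackey_gauge K & forall psi, polar K psi -> U (xs + psi).
Proof.
move=> Uxs; have : nbhs (xs : mackey X) (U : set (mackey X)).
  by apply: open_nbhs_nbhs; split.
by move=> [K gK KU]; exists K => // psi Kpsi; apply: KU; exists psi.
Qed.

Lemma envelope_weakly_compact xs s : U xs -> weakly_compact (envelope xs s).
Proof.
move=> Uxs; have [K gK KU] := mackey_neighborhood Uxs.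
pose S x := [set phi x + c phi | phi in U].
pose Y := [set x | has_ubound (S x)].
pose g x := sup (S x).
have S0 x : S x !=set0 by exists (xs x + c xs); exists xs.
have gle x phi : Y x -> U phi -> phi x + c phi <= g x.
  by move=> Yx Uphi; apply: ub_le_sup => //; exists phi.
have -> : envelope xs s = [set x | Y x /\ g x - xs x <= s].
  apply/seteqP; split=> x.
    move=> hx; have ub : ubound (S x) (s + xs x).
      by move=> _ [phi Uphi <-]; have := hx phi Uphi; lra.
    by split; [exists (s + xs x)|rewrite lerBlDr; exact: ge_sup].
  by move=> [Yx gx] phi Uphi; have := gle x phi Yx Uphi; lra.
apply: (@weakly_compact_of_attainment R X Y (fun x => g x - xs x) K) => //.
  move=> psi /KU Up; have [u fu] := f_eq Up.
  have ub : ubound (S u) ((xs + psi : dual X) u + c (xs + psi)).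
    by move=> _ [phi Uphi <-]; rewrite -lee_fin -fu f_ge.
  have Yu : Y u by exists ((xs + psi : dual X) u + c (xs + psi)).
  exists u => // x Yx; have := gle x _ Yx Up.
  have : g u <= (xs + psi : dual X) u + c (xs + psi) by exact: ge_sup.
  by rewrite !dualE_add; lra.
rewrite (_ : [set x | _] = envelope xs s); first exact: envelope_closed.
apply/seteqP; split=> x.
  by move=> [Yx gx] phi Uphi; have := gle x phi Yx Uphi; lra.
move=> hx; have ub : ubound (S x) (s + xs x).
  by move=> _ [phi Uphi <-]; have := hx phi Uphi; lra.
by split; [exists (s + xs x)|rewrite lerBlDr; exact: ge_sup].
Qed.

Lemma sublevel_relatively_weakly_compact xs s : U xs ->
  relatively_weakly_compact [set x | (f x - (xs x)%:E <= s%:E)%E].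
Proof.
move=> Uxs.
apply: (@subclosed_compact (weak X) _ (envelope xs s)).
- exact: closed_closure.
- exact: envelope_weakly_compact.
have := @envelope_closed xs s => /closure_id ->.
by apply: closure_subset => x; exact: sublevel_envelope.
Qed.

Lemma epigraph_relatively_weakly_compact xs s : U xs ->
  relatively_weakly_compact
    [set p : X * R^o | (f p.1 - (xs p.1)%:E <= p.2%:E <= s%:E)%E].
Proof.
move=> Uxs.
pose Q := [set p : X * R^o | envelope xs s p.1 /\ c xs <= p.2 <= s].
have clQ : closed (Q : set (weak (X * R^o)%type)).
  have [pr2 hpr2] := @dual_snd R X.
  have -> : Q = \bigcap_(phi in U) [set p | (phi - xs : dual X) p.1 <= s - c phi]
      `&` ([set p | (- pr2 : dual _) p <= - c xs] `&` [set p | pr2 p <= s]).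
    apply/seteqP; split=> p.
      move=> [hp /andP[cp ps]]; split; last first.
        split; last by rewrite /= hpr2.
        by change (- pr2 p <= - c xs); rewrite hpr2 lerN2.
      move=> phi Uphi; have := hp phi Uphi.
      change (phi p.1 + c phi - xs p.1 <= s -> phi p.1 - xs p.1 <= s - c phi); lra.
    move=> [hp [cp0 ps]]; have cp : - pr2 p <= - c xs := cp0.
    rewrite hpr2 lerN2 in cp; rewrite /= hpr2 in ps.
    split; last by rewrite cp.
    move=> phi Uphi; have := hp phi Uphi.
    change (phi p.1 - xs p.1 <= s - c phi -> phi p.1 + c phi - xs p.1 <= s); lra.
  apply: closedI; last by apply: closedI; exact: weak_closed_halfspace.
  apply: closed_bigI => phi _; have [psi hpsi] := dual_fst (phi - xs).
  have -> : [set p : X * R^o | (phi - xs : dual X) p.1 <= s - c phi] =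
      [set p | psi p <= s - c phi].
    by apply/funext => p; rewrite /= hpsi.
  exact: weak_closed_halfspace.
apply: (@subclosed_compact (weak (X * R^o)%type) _ Q).
- exact: closed_closure.
- by apply: weakly_compact_setX_segment; exact: envelope_weakly_compact.
 move/closure_id: clQ => ->; apply: closure_subset => p /andP[fp ps].
split; first by apply: sublevel_envelope; exact: le_trans ps.
rewrite lee_fin in ps; rewrite ps andbT -lee_fin; apply: le_trans fp.
have := @f_ge xs p.1 Uxs; rewrite EFinD addeC -leeBrDr//.
Qed.

Lemma conjugateE phi : U phi -> conjugate f phi = (- c phi)%:E.
Proof.
move=> Uphi; apply/eqP; rewrite /conjugate eq_le; apply/andP; split.
  apply: ge_ereal_sup => _ [x _ <-]; have := @f_ge phi x Uphi.
  case: (f x) => [r| |] //; last by rewrite addeNy leNye.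
  by rewrite -EFinB !lee_fin; lra.
have [u fu] := f_eq Uphi; apply: ereal_sup_ubound; exists u => //.
by rewrite fu -EFinB; congr EFin; ring.
Qed.

Lemma envelope_minorant x phi s : U phi -> f x = s%:E -> phi x + c phi <= s.
Proof. by move=> Uphi fx; rewrite -lee_fin -fx; exact: f_ge. Qed.

(* By convexity a point where the envelope exceeds its minimum by [r >= 1] lies
   at gauge distance at most [r] from the minimizer [u], for the gauge of the
   sublevel set at height one. *)
Lemma conjugate_near xs e : U xs -> 0 < e <= 1 ->
  nbhs (xs : mackey X) [set phi : mackey X | U phi /\ `|c phi - c xs| <= 2 * e].
Proof.
move=> Uxs /andP[e0 e1]; have [u fu] := f_eq Uxs.
pose L := envelope xs (c xs + 1).
have u_in : envelope xs (c xs) u.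
  by move=> phi Uphi; have := envelope_minorant Uphi fu; lra.
have Lu : L u by move=> phi /u_in; lra.
have cL : weakly_compact L by exact: envelope_weakly_compact.
have vL : convex_subset L.
  by move=> x y s Lx Ly s01; apply: envelope_convex Lx Ly s01 _; lra.
have [K1 gK1 K1U] := mackey_neighborhood Uxs.
pose K2 := [set e^-1 *: x | x in [set x - y | x in L & y in L]].
have gK2 : mackey_gauge K2.
  by apply: mackey_gauge_scale; exact: mackey_gauge_difference.
pose K3 := [set a *: (e^-1 *: u) | a in [set a : R | `|a| <= 1]].
have near3 K : mackey_gauge K -> nbhs (xs : mackey X)
    [set phi : mackey X | exists2 psi, polar K psi & phi = xs + psi].
  by move=> gK; exists K => // _ [psi Kpsi <-]; exists psi.
have nF : Filter (nbhs (xs : mackey X)) by exact: nbhs_filter.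
have near23 := @filterI _ _ nF _ _ (near3 K2 gK2)
  (near3 K3 (mackey_gauge_segment _)).
apply: (@filterS _ _ nF _ _ _ (@filterI _ _ nF _ _ (near3 K1 gK1) near23)).
move=> phi [[psi /K1U Up phiE] [[psi' K2psi phiE'] [psi'' K3psi phiE'']]].
have E1 : psi' = psi by apply: (addrI xs); rewrite -phiE -phiE'.
have E2 : psi'' = psi by apply: (addrI xs); rewrite -phiE -phiE''.
rewrite {}E1 in K2psi; rewrite {}E2 in K3psi.
rewrite phiE; split=> //.
have psiL x : L x -> psi x - psi u <= e.
  move=> Lx; move/polarP: K2psi => /(_ (e^-1 *: (x - u))).
  have -> : psi (e^-1 *: (x - u)) = e^-1 * (psi x - psi u).
    by rewrite dualZ (linear_formB _ _ (dual_linear_form psi)).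
  rewrite ler_pdivrMl// mulr1; apply; exists (x - u) => //.
  by exists x => //; exists u.
have psiu : `|psi u| <= e.
  have h a : `|a| <= 1 -> a * psi u <= e.
    move=> a1; move/polarP: K3psi => /(_ (a *: (e^-1 *: u))).
    rewrite !dualZ mulrCA ler_pdivrMl// mulr1; apply.
    by exists a.
  rewrite ler_norml; apply/andP; split; last first.
    by rewrite -[psi u]mul1r h ?normr1.
  by rewrite lerNl -mulN1r h ?normrN1.
have [v fv] := f_eq Up; rewrite dualE_add in fv.
have lower : c (xs + psi) <= c xs + e.
  have := envelope_minorant Up fu; rewrite dualE_add.
  by move: psiu; rewrite ler_norml; lra.
pose r := psi v + c (xs + psi) - c xs.
have v_in : envelope xs (c xs + r) v.
  by move=> phi' Uphi'; have := envelope_minorant Uphi' fv; rewrite /r; lra.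
have r0 : 0 <= r.
  by have := v_in xs Uxs; lra.
have upper : psi v - psi u <= r + e.
  have [r1|r1] := leP r 1.
    have Lv : L v by move=> phi' /v_in; lra.
    by have := psiL v Lv; lra.
  have r0' : 0 < r by lra.
  have rV : r^-1 * r = 1 by rewrite mulVf// gt_eqF.
  have t01 : 0 <= r^-1 <= 1 by rewrite invr_ge0 r0 invf_le1// ltW.
  have Lt : L (r^-1 *: v + (1 - r^-1) *: u).
    apply: envelope_convex v_in u_in t01 _; lra.
  have := psiL _ Lt; rewrite dualD !dualZ.
  have : r * (r^-1 * psi v + (1 - r^-1) * psi u - psi u) = psi v - psi u.
    have rV' : r * r^-1 = 1 by rewrite mulrC.
    rewrite [LHS](_ : _ = r * r^-1 * (psi v - psi u)); last by ring.
    by rewrite rV' mul1r.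
  move=> <-; nra.
rewrite ler_norml; apply/andP; split; last lra.
move: psiu upper; rewrite ler_norml /r; lra.
Qed.

Lemma conjugate_epi_pointed : (forall x, -oo < f x)%E -> U !=set0 -> epi_pointed f.
Proof.
move=> f_gtNy [xs Uxs]; split.
  split; last by exists xs; rewrite /edom/= conjugateE// ltry.
  move=> phi; have [u fu] := f_eq Uxs.
  apply: (@lt_le_trans _ _ ((phi u)%:E - f u)%E); first by rewrite fu -EFinB ltNyr.
  by apply: ereal_sup_ubound; exists u.
exists xs; split; first by rewrite /edom/= conjugateE// ltry.
have UN : nbhs (xs : mackey X) (U : set (mackey X)).
  by apply: open_nbhs_nbhs; split.
have nF : Filter (nbhs (xs : mackey X)) by exact: nbhs_filter.
change (conjugate f @ (xs : mackey X) --> conjugate f xs); rewrite (conjugateE Uxs).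
apply: (@cvg_trans _ ((fun phi : mackey X => (- c phi)%:E) @ (xs : mackey X))).
  apply: near_eq_cvg; apply: (@filterS _ _ nF _ _ _ UN) => phi Uphi.
  by rewrite /= conjugateE.
apply: (@cvg_EFin _ _ _ nF); first exact: (@nearW _ _ _ nF).
apply/(@cvgrPdist_le _ R^o _ _ nF) => e e0 /=.
pose e' := Num.min 1 (e / 2).
have e'01 : 0 < e' <= 1 by rewrite lt_min ge_min lexx ltr01 divr_gt0.
have e'e : e' <= e / 2 by rewrite ge_min lexx orbT.
apply: (@filterS _ _ nF _ _ _ (conjugate_near Uxs e'01)) => phi [_ h].
by rewrite opprK addrC; apply: le_trans h _; lra.
Qed.

End epigraph.

Unset Implicit Arguments.
Local Open Scope ereal_scope.

Theorem theorem3p9 (R : realType) (X : tvsType R)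
    (X_hausdorff : hausdorff_space X) (X_complete : tvs_complete X)
    (U : set (mackey X)) (U_nonempty : U !=set0) (U_open : open U)
    (f : X -> \bar R) (f_gtNy : forall x, -oo < f x)
    (f_min : forall xs : mackey X, U xs -> attains_min_sub f xs) :
  (forall (gamma : R) (xs : mackey X), U xs ->
     relatively_weakly_compact
       [set p : X * R^o | f p.1 - (xs p.1)%:E <= p.2%:E <= gamma%:E] /\
     relatively_weakly_compact
       [set x : X | f x - (xs x)%:E <= gamma%:E]) /\
  epi_pointed f.
Proof.
have /choice[c hc] : forall phi : mackey X, exists c : R, U phi ->
    (forall x, ((phi : dual X) x + c)%:E <= f x) /\
    exists u, f u = ((phi : dual X) u + c)%:E.
  move=> phi; have [/f_min[u [fu hu]]|nU] := pselect (U phi); last by exists 0%R.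
  move: hu; rewrite -(fineK fu) => hu; exists (fine (f u) - phi u)%R => _; split.
    move=> x; rewrite addrC EFinD -leeBrDr//; exact: le_trans (hu x).
  by exists u; rewrite -[LHS](fineK fu) addrC subrK.
have f_ge (phi : dual X) x : U phi -> (phi x + c phi)%:E <= f x.
  by move=> /hc[+ _]; apply.
have f_eq (phi : dual X) : U phi -> exists u, f u = (phi u + c phi)%:E.
  by move=> /hc[].
split; last first.
  exact: conjugate_epi_pointed X_complete U_open f_ge f_eq f_gtNy U_nonempty.
move=> gamma xs Uxs; split.
  exact: (epigraph_relatively_weakly_compact X_complete U_open f_ge f_eq).
exact: (sublevel_relatively_weakly_compact X_complete U_open f_ge f_eq).
Qed.
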